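(* Let $n\ge 1$, $H\in\mathbb{R}$, and let $(M_i^n,p_i)$ be complete $n$-dimensional Riemannian manifolds with $\mathrm{Ric}\ge(n-1)H$ that converge in the pointed Gromov-Hausdorff sense to a length space $(Y,y)$. Fix any $R>0$ and $r\in(0,R/3)$. Let $r_i\to r$ and $R_i\to R$ be radii such that $B(p_i,r_i)$ and $B(p_i,R_i)$ in $M_i$ with intrinsic metrics converge to $B(y,r)$ and $B(y,R)$ in $Y$ with intrinsic metrics. Then for all $\delta\in(0,r/2)$ the relative $\delta$-covers $(\tilde B(p_i,r_i,R_i)^\delta,\tilde p_i)$, with the intrinsic metric $d_{\tilde B(p_i,r_i,R_i)^\delta}$, have a convergent subsequence in the pointed Gromov-Hausdorff sense.
   Context: $B(p,R)$ denotes the closed ball in a length space, and $d_{B(p,R)}$ the induced length (intrinsic) metric on it. For an open covering $\mathcal U$ of a space $Z$ and $p\in Z$, $\tilde Z_{\mathcal U}$ is the covering space of $Z$ (Spanier) with covering group $\pi_1(Z,\mathcal U,p)$, the normal subgroup of $\pi_1(Z,p)$ generated by homotopy classes of closed paths of the form $\alpha^{-1}\circ\beta\circ\alpha$, where $\beta$ is a closed path lying in some element of $\mathcal U$ and $\alpha$ is a path from $p$ to $\beta(0)$. For $\delta>0$ the $\delta$-cover $\tilde Z^\delta$ of a length space $Z$ is $\tilde Z_{\mathcal U_\delta}$, where $\mathcal U_\delta$ consists of all open balls of radius $\delta$. For closed balls $B(p,r)\subset B(p,R)$ with $r<R$, the relative $\delta$-cover $\tilde B(p,r,R)^\delta$ is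 a connected lift of $B(p,r)$ to the $\delta$-cover $\tilde B(p,R)^\delta$ of $(B(p,R),d_{B(p,R)})$, i.e. a connected component of the preimage of $B(p,r)$; it carries its intrinsic length metric $d_{\tilde B(p,r,R)^\delta}$, and $\tilde p$ denotes a lift of $p$ in it. $(M_i,p_i)\to(Y,y)$ in the pointed Gromov-Hausdorff sense means that for every $R>0$ the closed balls $B(p_i,R)$ with restricted metrics converge to $B(y,R)$ with restricted metric (base points corresponding). *)

(* Defs.v *)
From HB Require Import structures.
From mathcomp Require Import all_boot all_order all_algebra.
From mathcomp Require Import all_classical all_reals all_analysis.

Set Implicit Arguments.
Unset Strict Implicit.
Unset Printing Implicit Defensive.

Import Order.TTheory GRing.Theory Num.Theory.
Import numFieldNormedType.Exports.

Local Open Scope classical_set_scope.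
Local Open Scope ring_scope.

(* Distances are extended-real valued throughout: an intrinsic distance is +oo
   between points that no rectifiable path joins. *)

Section ExtendedDistances.
Context {K : realType}.

Definition cball (T : Type) (d : T -> T -> \bar K) (x : T) (r : K) : set T :=
  [set y | (d x y <= r%:E)%E].

Definition oball (T : Type) (d : T -> T -> \bar K) (x : T) (r : K) : set T :=
  [set y | (d x y < r%:E)%E].

Definition emdist (M : metricType K) (x y : M) : \bar K := (mdist x y)%:E.

(* The type T, with the topology whose open sets are the U that contain, with
   each point, a d-ball around it. *)
Definition edist_space (T : Type) (d : T -> T -> \bar K) : Type := T.

End ExtendedDistances.

Section EdistTopology.
Context {K : realType} (T : Type) (d : T -> T -> \bar K).

Let op : set_system (edist_space d) :=
  [set U | forall x, U x -> exists2 e : K, 0 < e & oball d x e `<=` U].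

Let opT : op setT.
Proof. by move=> x _; exists 1. Qed.

Let opI : setI_closed op.
Proof.
move=> U V oU oV x [Ux Vx].
have [e e0 eU] := oU x Ux; have [e' e'0 eV] := oV x Vx.
exists (Num.min e e'); first by rewrite lt_min e0.
move=> y; rewrite /oball /= => xy; split.
- by apply: eU; apply: (lt_le_trans xy); rewrite lee_fin ge_min lexx.
- by apply: eV; apply: (lt_le_trans xy); rewrite lee_fin ge_min lexx orbT.
Qed.

Let op_bigU (I : Type) (f : I -> set (edist_space d)) :
  (forall i, op (f i)) -> op (\bigcup_i f i).
Proof.
move=> opf x [i _ fix_]; have [e e0 ef] := opf i x fix_.
by exists e => // y xy; exists i => //; exact: ef.
Qed.

HB.instance Definition _ := gen_eqMixin (edist_space d).
HB.instance Definition _ := gen_choiceMixin (edist_space d).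
HB.instance Definition _ :=
  isOpenTopological.Build (edist_space d) opT opI op_bigU.

End EdistTopology.

(* A path is a function on K of which only the values on [0, 1] matter. *)
Section Paths.
Context {K : realType}.

Definition is_path (T : topologicalType) (x y : T) (f : K -> T) : Prop :=
  [/\ {within `[0, 1], continuous f}, f 0 = x & f 1 = y].

Definition path_cat (T : Type) (f g : K -> T) : K -> T :=
  fun t => if t <= 2^-1 then f (2 * t) else g (2 * t - 1).

Definition path_rev (T : Type) (f : K -> T) : K -> T := fun t => f (1 - t).

(* Homotopy relative to the endpoints. *)
Definition path_homotopic (T : topologicalType) (f g : K -> T) : Prop :=
  exists H : K * K -> T,
    [/\ {within `[0, 1] `*` `[0, 1], continuous H},
        {in `[0, 1], forall t, H (t, 0) = f t},
        {in `[0, 1], forall t, H (t, 1) = g t},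
        {in `[0, 1], forall s, H (0, s) = f 0} &
        {in `[0, 1], forall s, H (1, s) = f 1}].

(* Compare [total_variation] in realfun.v. *)
Definition path_length (T : Type) (d : T -> T -> \bar K) (f : K -> T) : \bar K :=
  ereal_sup [set (\sum_(0 <= k < size s)
                    d (f (nth 1%R (0%R :: s) k)) (f (nth 1%R s k)))%E
            | s in [set s : seq K | itv_partition 0 1 s]].

(* The length metric that d induces on A. *)
Definition intrinsic_dist (T : topologicalType) (d : T -> T -> \bar K)
    (A : set T) (x y : T) : \bar K :=
  ereal_inf [set path_length d f
            | f in [set f | is_path x y f /\ f @` `[0, 1] `<=` A]].

Definition is_length_space (Y : metricType K) : Prop :=
  forall x y : Y, emdist x y = intrinsic_dist (@emdist K Y) setT x y.

End Paths.

Section GromovHausdorff.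
Context {K : realType}.

Definition hausdorff_dist (T : Type) (d : T -> T -> \bar K) (A B : set T) :
    \bar K :=
  ereal_inf [set e%:E | e in [set e : K |
    [/\ 0 < e,
        forall x, A x -> exists2 y, B y & (d x y <= e%:E)%E &
        forall y, B y -> exists2 x, A x & (d x y <= e%:E)%E]]].

Definition is_epseudometric (T : Type) (D : set T) (d : T -> T -> \bar K) :
    Prop :=
  [/\ forall x, D x -> d x x = 0%E,
      forall x y, D x -> D y -> (0 <= d x y)%E,
      forall x y, D x -> D y -> d x y = d y x &
      forall x y z, D x -> D y -> D z -> (d x z <= d x y + d y z)%E].

(* The pseudometrics on the disjoint union of A and B that extend dA and dB. *)
Definition gh_admissible (S T : Type) (A : set S) (dA : S -> S -> \bar K)
    (B : set T) (dB : T -> T -> \bar K) : set (S + T -> S + T -> \bar K) :=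
  [set rho | [/\ is_epseudometric (inl @` A `|` inr @` B) rho,
    forall x x', A x -> A x' -> rho (inl x) (inl x') = dA x x' &
    forall y y', B y -> B y' -> rho (inr y) (inr y') = dB y y']].

Definition gh_dist (S T : Type) (A : set S) (dA : S -> S -> \bar K)
    (B : set T) (dB : T -> T -> \bar K) : \bar K :=
  ereal_inf [set hausdorff_dist rho (inl @` A) (inr @` B)
            | rho in gh_admissible A dA B dB].

Definition pointed_gh_dist (S T : Type) (A : set S) (dA : S -> S -> \bar K)
    (a : S) (B : set T) (dB : T -> T -> \bar K) (b : T) : \bar K :=
  ereal_inf [set maxe (hausdorff_dist rho (inl @` A) (inr @` B))
                      (rho (inl a) (inr b))
            | rho in gh_admissible A dA B dB].

Definition gh_cvg (S : nat -> Type) (A : forall i, set (S i))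
    (dA : forall i, S i -> S i -> \bar K)
    (T : Type) (B : set T) (dB : T -> T -> \bar K) : Prop :=
  gh_dist (A i) (dA i) B dB @[i --> \oo] --> 0%E.

Definition pointed_gh_cvg (S : nat -> Type) (A : forall i, set (S i))
    (dA : forall i, S i -> S i -> \bar K) (a : forall i, S i)
    (T : Type) (B : set T) (dB : T -> T -> \bar K) (b : T) : Prop :=
  forall s : K, 0 < s ->
    pointed_gh_dist (A i `&` cball (dA i) (a i) s) (dA i) (a i)
                    (B `&` cball dB b s) dB b @[i --> \oo] --> 0%E.

End GromovHausdorff.

Section Covers.
Context {K : realType}.

Definition is_covering_map (E Z : topologicalType) (f : E -> Z) : Prop :=
  [/\ continuous f, range f = setT &
   forall z, exists U : set Z, [/\ open U, U z &
     exists F : set (set E),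
       [/\ f @^-1` U = \bigcup_(V in F) V,
           trivIset F id &
           forall V, F V -> [/\ open V, {in V &, injective f}, f @` V = U &
             forall W, open W -> W `<=` V -> open (f @` W)]]]].

(* The loops at z whose homotopy class is in pi_1(Z, U, z). The subgroup that
   the classes of the lassos generate is already normal. *)
Inductive cover_group (Z : topologicalType) (U : set (set Z)) (z : Z) :
    (K -> Z) -> Prop :=
  | cover_group_lasso (x : Z) (a b : K -> Z) (V : set Z) :
      is_path z x a -> is_path x x b -> U V -> b @` `[0, 1] `<=` V ->
      cover_group U z (path_cat (path_cat a b) (path_rev a))
  | cover_group_cst : cover_group U z (fun=> z)
  | cover_group_cat (a b : K -> Z) : cover_group U z a -> cover_group U z b ->
      cover_group U z (path_cat a b)
  | cover_group_rev (a : K -> Z) : cover_group U z a ->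
      cover_group U z (path_rev a)
  | cover_group_homotopic (a b : K -> Z) : cover_group U z a ->
      is_path z z b -> path_homotopic a b -> cover_group U z b.

(* f is the connected covering of Z for which the image of pi_1(E, e) is
   pi_1(Z, U, z), for some e over z. *)
Definition is_U_cover (E Z : topologicalType) (U : set (set Z)) (z : Z)
    (f : E -> Z) : Prop :=
  [/\ is_covering_map f, connected [set: E] &
   exists2 e : E, f e = z &
     forall a : K -> Z, is_path z z a ->
       (cover_group U z a <->
        exists2 b : K -> E, is_path e e b & path_homotopic (f \o b) a)].

Definition delta_balls (T : Type) (d : T -> T -> \bar K) (delta : K) :
    set (set (edist_space d)) :=
  [set oball d x delta | x in setT].

Definition is_delta_cover (T : Type) (d : T -> T -> \bar K) (delta : K)
    (z : edist_space d) (E : topologicalType) (f : E -> edist_space d) : Prop :=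
  is_U_cover (@delta_balls T d delta) z f.

(* The length metric of a covering space: a path has the length of its
   projection. *)
Definition lift_dist (T : Type) (d : T -> T -> \bar K) (E : topologicalType)
    (f : E -> edist_space d) (x y : E) : \bar K :=
  ereal_inf [set path_length d (f \o a) | a in [set a | is_path x y a]].

End Covers.

Arguments delta_balls {K T} d delta.
Arguments is_delta_cover {K T} d delta z {E} f.
Arguments lift_dist {K T} d {E} f x y.

Section RelativeCovers.
Context {K : realType}.
Variables (M : metricType K) (p : M) (R : K).

Definition ball_dist (x y : cball (@emdist K M) p R) : \bar K :=
  intrinsic_dist (@emdist K M) (cball (@emdist K M) p R) (val x) (val y).

(* B(p, R) with the topology of its intrinsic metric, which near the boundary
   can be finer than the topology induced by M. *)
Definition intrinsic_ball := edist_space ball_dist.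

Variables (E : topologicalType) (f : E -> intrinsic_ball) (r : K) (pt : E).

Definition to_space (z : intrinsic_ball) : M :=
  val (z : cball (@emdist K M) p R).

Definition rel_cover : set E :=
  connected_component [set e | cball (@emdist K M) p r (to_space (f e))] pt.

Definition rel_cover_dist : E -> E -> \bar K :=
  intrinsic_dist (lift_dist ball_dist f) rel_cover.

End RelativeCovers.

Section CoordinateCalculus.
Context {K : realType} {n : nat}.
Implicit Types (D : set 'rV[K]_n) (G : 'rV[K]_n -> 'M[K]_n).

Definition partial (k : 'I_n) (f : 'rV[K]_n -> K) (x : 'rV[K]_n) : K :=
  'D_(delta_mx 0 k) f x.

(* To be used for open D. *)
Fixpoint C_k (m : nat) D (f : 'rV[K]_n -> K) : Prop :=
  (forall x, D x -> {for x, continuous f}) /\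
  if m is m'.+1 then
    forall k, (forall x, D x -> derivable f x (delta_mx 0 k)) /\
              C_k m' D (partial k f)
  else True.

Definition smooth_on D (f : 'rV[K]_n -> K) : Prop := forall m, C_k m D f.

Definition qform (A : 'M[K]_n) (v : 'rV[K]_n) : K := (v *m A *m v^T) 0 0.

(* Gamma^k_{ab} *)
Definition christoffel G (a b k : 'I_n) (x : 'rV[K]_n) : K :=
  2^-1 * \sum_l invmx (G x) k l *
    (partial a (fun y => G y b l) x + partial b (fun y => G y a l) x
     - partial l (fun y => G y a b) x).

(* Ric_{ab} = d_k Gamma^k_{ab} - d_b Gamma^k_{ak}
              + Gamma^k_{kl} Gamma^l_{ab} - Gamma^k_{bl} Gamma^l_{ak} *)
Definition ricci G (x : 'rV[K]_n) : 'M[K]_n :=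
  \matrix_(a, b)
   (\sum_k (partial k (christoffel G a b k) x
            - partial b (christoffel G a k k) x)
    + \sum_k \sum_l
        (christoffel G k l k x * christoffel G a b l x
         - christoffel G b l k x * christoffel G a k l x)).

Definition is_C1_curve (u : K -> 'rV[K]_n) : Prop :=
  (forall t, derivable u t 1) /\ continuous (derive1 u).

Definition curve_length G (u : K -> 'rV[K]_n) : \bar K :=
  (\int[lebesgue_measure]_(t in `[0%R, 1%R])
     (Num.sqrt (qform (G (u t)) (derive1 u t)))%:E)%E.

End CoordinateCalculus.

Section Riemannian.
Context {K : realType}.

Record chart (n : nat) (M : Type) := Chart {
  chart_dom : set M;
  chart_map : M -> 'rV[K]_n;
  chart_inv : 'rV[K]_n -> M
}.

Definition chart_im (n : nat) (M : Type) (c : chart n M) : set 'rV[K]_n :=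
  chart_map c @` chart_dom c.

Definition is_chart (n : nat) (M : topologicalType) (c : chart n M) : Prop :=
  [/\ open (chart_dom c), open (chart_im c),
      forall x, chart_dom c x -> chart_inv c (chart_map c x) = x,
      {within chart_dom c, continuous (chart_map c)} &
      {within chart_im c, continuous (chart_inv c)}].

Definition transition (n : nat) (M : Type) (c c' : chart n M) :
    'rV[K]_n -> 'rV[K]_n :=
  chart_map c' \o chart_inv c.

(* A piecewise C^1 curve from x to y, cut into pieces that lie in one chart
   each, together with its length. *)
Inductive pw_C1_curve (n : nat) (M : Type) (atlas : set (chart n M))
    (G : chart n M -> 'rV[K]_n -> 'M[K]_n) : M -> M -> \bar K -> Prop :=
  | pw_C1_nil (x : M) : pw_C1_curve atlas G x x 0%E
  | pw_C1_cons (c : chart n M) (u : K -> 'rV[K]_n) (z : M) (l : \bar K) :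
      atlas c -> is_C1_curve u -> u @` `[0, 1] `<=` chart_im c ->
      pw_C1_curve atlas G (chart_inv c (u 1)) z l ->
      pw_C1_curve atlas G (chart_inv c (u 0)) z (curve_length (G c) u + l)%E.

(* A connected Riemannian n-manifold is given as a metric space M, together
   with a smooth atlas and a metric tensor (in coordinates) whose Riemannian
   distance is the distance of M. The latter being finite, M is connected. *)
Record riemannian (n : nat) (M : metricType K) := Riemannian {
  atlas : set (chart n M);
  tensor : chart n M -> 'rV[K]_n -> 'M[K]_n;
  atlas_chart : forall c, atlas c -> is_chart c;
  atlas_cover : forall x, exists2 c, atlas c & chart_dom c x;
  atlas_smooth : forall c c', atlas c -> atlas c' -> forall k,
    smooth_on (chart_map c @` (chart_dom c `&` chart_dom c'))
              (fun x => transition c c' x 0 k);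
  tensor_smooth : forall c, atlas c -> forall a b,
    smooth_on (chart_im c) (fun x => tensor c x a b);
  tensor_sym : forall c x, atlas c -> chart_im c x ->
    (tensor c x)^T = tensor c x;
  tensor_pos : forall c x v, atlas c -> chart_im c x -> v != 0 ->
    0 < qform (tensor c x) v;
  tensor_transition : forall c c', atlas c -> atlas c' ->
    forall x, (chart_map c @` (chart_dom c `&` chart_dom c')) x ->
    let J := jacobian (transition c c') x in
    tensor c x = J *m tensor c' (transition c c' x) *m J^T;
  riemannian_dist : forall x y : M,
    emdist x y = ereal_inf [set l | pw_C1_curve atlas tensor x y l]
}.

Definition ricci_ge (n : nat) (M : metricType K) (g : riemannian n M) (h : K) :
    Prop :=
  forall c x (v : 'rV[K]_n), atlas g c -> chart_im c x ->
    h * qform (tensor g c x) v <= qform (ricci (tensor g c) x) v.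

Definition complete_metric (M : metricType K) : Prop :=
  forall F : set_system M, ProperFilter F -> cauchy F -> exists x : M, F --> x.

End Riemannian.

(* Main.v *)
(* By Hopf-Rinow the balls of M_i are totally bounded and points are joined by
   minimal geodesics; moving a point of B(p_i, r_i) towards the center shows
   that the ball is totally bounded for its intrinsic metric as well, hence
   uniformly so in i because these balls converge. In the delta-cover the short
   loops of the base lift to loops, so a point of the base has at most one lift
   in a small ball: a net of B(p_i, r_i) yields, in every ball of a fixed small
   radius of the relative cover, a net with no more points. Since the relative
   cover is a length space, this propagates to balls of any radius, and
   Gromov's precompactness theorem applies; the limit is an ultralimit of the
   covers, and the subsequence is picked from sets of the ultrafilter. *)

From HB Require Import structures.
Require Import Defs.
From mathcomp Require Import all_boot all_order all_algebra.
From mathcomp Require Import all_classical all_reals all_analysis.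
From mathcomp Require Import ring lra.

Set Implicit Arguments.
Unset Strict Implicit.
Unset Printing Implicit Defensive.

Import Order.TTheory GRing.Theory Num.Theory.
Import numFieldNormedType.Exports.

Local Open Scope classical_set_scope.
Local Open Scope ring_scope.

(** * Paths and their length *)

Section ContinuousOnIntervals.
Context {K : realType}.

(** Two points shape the argument. Pointed convergence compares closed balls of the same radius [s]
    on both sides, so a point near the boundary of one ball needs a partner inside the other; nets
    alone would place it in a slightly larger ball. Points are therefore first moved towards the
    base point by a few multiples of the net size. This is what [radially_divisible] provides, and
    it has to survive in the limit together with the nets. Secondly, nets live in the metric of the
    component over B(p, r), while uniqueness of lifts is a property of the whole cover of B(p, R).
    The metric of the component dominates that of the cover, so two nearby lifts of one point are
    joined by a path of length less than [delta] in the cover. Its projection is a loop inside one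
    [delta]-ball, the loop of a lasso in the covering group, and such a loop lifts to a closed path.
    Lifting, its uniqueness and the lifting of homotopies all rest on one induction principle for
    intervals, [cousin]. *)

Definition cont_on (T : topologicalType) (a b : K) (f : K -> T) : Prop :=
  forall t, a <= t <= b -> forall W, open W -> W (f t) ->
  exists2 e : K, 0 < e & forall s, a <= s <= b -> `|s - t| < e -> W (f s).

Lemma within_itvP (T : topologicalType) (a b : K) (f : K -> T) :
  {within `[a, b], continuous f} <-> cont_on a b f.
Proof.
split=> [/subspace_continuousP cf t tab W oW Wt|cf].
  have /cf : [set` `[a, b]] t by rewrite /= in_itv.
  move=> /(_ W) []; first exact: open_nbhs_nbhs.
  move=> e /= e0 eW; exists e => // s sab st.
  by apply: eW; rewrite /= ?in_itv// distrC.
apply/subspace_continuousP => t /=; rewrite in_itv/= => tab P.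
rewrite nbhsE => -[W [oW Wt] WP].
have [e e0 eW] := cf t tab W oW Wt.
exists e => //= s; rewrite /ball_ /= distrC => st; rewrite in_itv/= => sab.
exact/WP/eW.
Qed.

Lemma cont_onW (T : topologicalType) (a b a' b' : K) (f : K -> T) :
  a <= a' -> b' <= b -> cont_on a b f -> cont_on a' b' f.
Proof.
move=> aa bb cf t /andP[ta tb] W oW Wt.
have [|e e0 eW] := cf t _ W oW Wt; first by rewrite (le_trans aa)//= (le_trans tb).
exists e => // s /andP[sa sb]; apply: eW.
by rewrite (le_trans aa)//= (le_trans sb).
Qed.

Lemma cont_on_ext (T : topologicalType) (a b : K) (f g : K -> T) :
  (forall t, a <= t <= b -> f t = g t) -> cont_on a b f -> cont_on a b g.
Proof.
move=> fg cf t tab W oW; rewrite -(fg t tab) => Wt.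
have [e e0 eW] := cf t tab W oW Wt.
by exists e => // s sab st; rewrite -(fg s sab); exact: eW.
Qed.

Lemma cont_on_cst (T : topologicalType) (a b : K) (x : T) :
  cont_on a b (fun=> x).
Proof. by move=> t _ W _ Wx; exists 1. Qed.

Lemma cont_on_comp (S T : topologicalType) (a b : K) (f : K -> S) (g : S -> T) :
  continuous g -> cont_on a b f -> cont_on a b (g \o f).
Proof.
move=> cg cf t tab W oW Wt; apply: (cf t tab (g @^-1` W)) => //.
by apply: open_comp => // x _; exact: cg.
Qed.

Lemma cont_on_affine (T : topologicalType) (a b c k : K) (f : K -> T) :
  cont_on a b f -> forall a' b',
  (forall t, a' <= t <= b' -> a <= c + k * t <= b) ->
  cont_on a' b' (fun t => f (c + k * t)).
Proof.
move=> cf a' b' hab t tab W oW Wt.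
have [e e0 eW] := cf _ (hab t tab) W oW Wt.
exists (e / (`|k| + 1)); first by rewrite divr_gt0// ltr_wpDl.
move=> s sab st; apply: eW; first exact: hab.
have -> : c + k * s - (c + k * t) = k * (s - t) by ring.
rewrite normrM (@le_lt_trans _ _ ((`|k| + 1) * `|s - t|))//.
  by rewrite ler_wpM2r// lerDl.
by rewrite mulrC -ltr_pdivlMr// ltr_wpDl.
Qed.

Lemma cont_on_glue (T : topologicalType) (a b c : K) (f : K -> T) :
  cont_on a b f -> cont_on b c f -> cont_on a c f.
Proof.
move=> f1 f2 t /andP[at_ tc] W oW Wt.
have [tb|bt|tb] := ltgtP t b.
- have [|e e0 eW] := f1 t _ W oW Wt; first by rewrite at_ ltW.
  exists (Num.min e (b - t)); first by rewrite lt_min e0 subr_gt0.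
  move=> s /andP[sa sc]; rewrite lt_min => /andP[s1 s2]; apply: eW => //.
  by rewrite sa/=; move: s2; rewrite ltr_norml => /andP[_]; lra.
- have [|e e0 eW] := f2 t _ W oW Wt; first by rewrite ltW.
  exists (Num.min e (t - b)); first by rewrite lt_min e0 subr_gt0.
  move=> s /andP[sa sc]; rewrite lt_min => /andP[s1 s2]; apply: eW => //.
  by rewrite sc andbT; move: s2; rewrite ltr_norml => /andP[+ _]; lra.
- subst b.
  have [|e e0 eW] := f1 t _ W oW Wt; first by rewrite at_ lexx.
  have [|e' e'0 eW'] := f2 t _ W oW Wt; first by rewrite tc lexx.
  exists (Num.min e e'); first by rewrite lt_min e0.
  move=> s /andP[sa sc]; rewrite lt_min => /andP[s1 s2].
  have [st|st] := leP s t; first by apply: eW => //; rewrite sa st.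
  by apply: eW' => //; rewrite sc (ltW st).
Qed.

(** Compactness of [a, b] as an induction principle: a property of intervals that passes to unions
    of adjacent intervals and holds on every small interval around each point holds on [a, b]. The
    supremum of the [t] with [Q a t] is attained and cannot lie before [b]. *)
Lemma cousin (a b : K) (Q : K -> K -> Prop) : a <= b ->
  (forall s t u, a <= s -> s <= t -> t <= u -> u <= b ->
     Q s t -> Q t u -> Q s u) ->
  (forall t, a <= t <= b -> exists2 e, 0 < e &
     forall s u, a <= s -> s <= t -> t <= u -> u <= b -> `|s - t| < e ->
       `|u - t| < e -> Q s u) ->
  Q a b.
Proof.
move=> ab Qtr Qloc.
pose S := [set t | [/\ a <= t, t <= b & Q a t]].
have aS : S a.
  split => //; have [|e e0] := Qloc a; first by rewrite lexx.
  by apply => //; rewrite subrr normr0.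
have supS : has_sup S by split; [exists a|exists b => t []].
have aub : a <= sup S by apply: ub_le_sup => //; case: supS.
have ubb : sup S <= b by apply: ge_sup; [exists a|move=> t []].
have [|e e0 eQ] := Qloc (sup S); first by rewrite aub.
have [t [at_ tb Qt] tS] := sup_adherent e0 supS.
have tsup : t <= sup S by apply: ub_le_sup => //; case: supS.
have key u : sup S <= u -> u <= b -> `|u - sup S| < e -> Q a u.
  move=> su ub ue; apply: (Qtr a t u) => //; first exact: le_trans su.
  by apply: eQ => //; rewrite distrC ger0_norm ?subr_ge0//; lra.
have Qsup : Q a (sup S) by apply: key => //; rewrite subrr normr0.
have [->//|sb] := eqVneq b (sup S).
have sltb : sup S < b by rewrite lt_neqAle eq_sym sb.
(* A point beyond the supremum that is still within reach of the local hypothesis there. *)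
pose u := Num.min b (sup S + e / 2).
have su : sup S < u by rewrite lt_min sltb ltrDl divr_gt0.
have Su : S u.
  have ub : u <= b by rewrite ge_min lexx.
  split => //; first by apply: (le_trans aub); exact: ltW.
  apply: key => //; first exact: ltW.
  rewrite gtr0_norm ?subr_gt0// ltrBlDr (@le_lt_trans _ _ (sup S + e / 2))//.
    by rewrite ge_min lexx orbT.
  by lra.
have : u <= sup S by apply: ub_le_sup => //; case: supS.
by rewrite leNgt su.
Qed.

End ContinuousOnIntervals.

(** * Length of a path as an additive, continuous function of the interval *)

Section PathLength.
Context {K : realType} (T : Type) (d : T -> T -> \bar K).
Hypothesis d_epm : is_epseudometric setT d.

Let d0 x : d x x = 0%E. Proof. by case: d_epm => + _ _ _; exact. Qed.
Let dge0 x y : (0 <= d x y)%E. Proof. by case: d_epm => _ + _ _; exact. Qed.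
Let dsym x y : d x y = d y x. Proof. by case: d_epm => _ _ + _; exact. Qed.
Let dtri x y z : (d x z <= d x y + d y z)%E.
Proof. by case: d_epm => _ _ _; exact. Qed.

Fixpoint vsum (f : K -> T) (a : K) (s : seq K) : \bar K :=
  if s is b :: s' then (d (f a) (f b) + vsum f b s')%E else 0%E.

(* Chains are only weakly increasing here, so that [a = b] is not special. *)
Definition vlen (f : K -> T) (a b : K) : \bar K :=
  ereal_sup [set vsum f a s | s in [set s | path <=%R a s /\ last a s = b]].

Lemma vsum_ge0 f a s : (0 <= vsum f a s)%E.
Proof. by elim: s a => //= b s ih a; rewrite adde_ge0. Qed.

Lemma vsum_cat f a s t :
  vsum f a (s ++ t) = (vsum f a s + vsum f (last a s) t)%E.
Proof.
elim: s a => [|b s ih] a /=; first by rewrite add0e.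
by rewrite ih addeA.
Qed.

Lemma vsum_le_vlen f a s : path <=%R a s -> (vsum f a s <= vlen f a (last a s))%E.
Proof. by move=> sP; apply: ereal_sup_ubound; exists s. Qed.

Lemma vlen_ge0 f a b : a <= b -> (0 <= vlen f a b)%E.
Proof.
move=> ab; apply: (le_trans (vsum_ge0 f a [:: b])).
by have /= := @vsum_le_vlen f a [:: b]; rewrite ab; exact.
Qed.

Lemma vlen_dist f a b : a <= b -> (d (f a) (f b) <= vlen f a b)%E.
Proof.
move=> ab; have /= := @vsum_le_vlen f a [:: b].
by rewrite ab adde0; exact.
Qed.

Lemma vlen_leP f a b x :
  (forall s, path <=%R a s -> last a s = b -> (vsum f a s <= x)%E) ->
  (vlen f a b <= x)%E.
Proof. by move=> h; apply: ge_ereal_sup => _ [s [s1 s2] <-]; exact: h. Qed.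

Lemma path_le_last (a : K) s : path <=%R a s -> a <= last a s.
Proof.
by elim: s a => //= b s ih a /andP[ab /ih]; exact: le_trans.
Qed.

Lemma path_le_mem (a : K) s x : path <=%R a s -> x \in a :: s ->
  a <= x <= last a s.
Proof.
elim: s a => [|b s ih] a /=.
  by move=> _; rewrite inE => /eqP ->; rewrite lexx.
move=> /andP[ab bs]; rewrite inE => /predU1P[->|/(ih _ bs)/andP[bx ->]].
  by rewrite lexx (le_trans ab)// path_le_last.
by rewrite (le_trans ab).
Qed.

Lemma eq_vsum f g a s : path <=%R a s ->
  (forall t, a <= t <= last a s -> f t = g t) -> vsum f a s = vsum g a s.
Proof.
elim: s a => //= b s ih a /andP[ab bs] fg.
rewrite !fg ?lexx ?ab ?path_le_last//; last exact: le_trans (path_le_last bs).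
by rewrite ih// => t /andP[bt tl]; rewrite fg// (le_trans ab).
Qed.

Lemma eq_vlen f g a b :
  (forall t, a <= t <= b -> f t = g t) -> vlen f a b = vlen g a b.
Proof.
move=> fg; congr ereal_sup; apply/seteqP; split => _ [s [s1 s2] <-];
  by exists s => //; apply: eq_vsum => // t; rewrite s2 => /fg.
Qed.

Lemma vlen_mono f (h : K -> K) a b : {homo h : x y / x <= y} ->
  (vlen (f \o h) a b <= vlen f (h a) (h b))%E.
Proof.
move=> hh; apply: vlen_leP => s sP <-.
have -> : vsum (f \o h) a s = vsum f (h a) [seq h x | x <- s].
  by elim: s a {sP} => //= x s ih a; rewrite ih.
rewrite -last_map; apply: vsum_le_vlen.
by elim: s a sP => //= x s ih a /andP[ax xs]; rewrite hh// ih.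
Qed.

Lemma vsum_rev f a s : 
  vsum f (last a s) (rev (belast a s)) = vsum f a s.
Proof.
elim: s a => //= b s ih a; rewrite rev_cons -cats1 vsum_cat ih addeC/= adde0.
congr (_ + _)%E; rewrite dsym; congr (d _ (f _)).
case: s {ih} => //= c s.
by rewrite rev_cons last_rcons.
Qed.

Lemma vlen_anti f (h : K -> K) a b : {homo h : x y / y <= x >-> x <= y} ->
  (vlen (f \o h) a b <= vlen f (h b) (h a))%E.
Proof.
move=> hh; apply: vlen_leP => s sP <-.
have -> : vsum (f \o h) a s = vsum f (h a) [seq h x | x <- s].
  by elim: s a {sP} => //= x s ih a; rewrite ih.
rewrite -vsum_rev last_map.
have hl : last (h (last a s)) (rev (belast (h a) [seq h x | x <- s])) = h a.
  case: s sP => //= x s _.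
  by rewrite rev_cons last_rcons.
rewrite -[X in vlen f _ X]hl; apply: vsum_le_vlen.
rewrite -last_map rev_path.
by elim: s a sP {hl} => //= x s ih a /andP[ax xs]; rewrite hh// ih.
Qed.

(** Chains of the two halves concatenate. The two suprema are taken one after the other by moving a
    term across the inequality, which needs finite values; the case of infinite total length is
    therefore set apart. *)
Lemma vlen_split f a b c : a <= b -> b <= c ->
  (vlen f a b + vlen f b c <= vlen f a c)%E.
Proof.
move=> ab bc.
have key s t : path <=%R a s -> last a s = b -> path <=%R b t -> last b t = c ->
    (vsum f a s + vsum f b t <= vlen f a c)%E.
  move=> s1 s2 t1 t2; rewrite -{1}s2 -vsum_cat.
  have -> : c = last a (s ++ t) by rewrite last_cat s2 t2.
  by apply: vsum_le_vlen; rewrite cat_path s1 s2.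
have [->|lfin] := eqVneq (vlen f a c) +oo%E; first exact: leey.
have lF : vlen f a c \is a fin_num.
  by rewrite ge0_fin_numE ?ltey// vlen_ge0// (le_trans ab).
have sF s t : path <=%R a s -> last a s = b -> path <=%R b t -> last b t = c ->
    vsum f a s \is a fin_num.
  move=> s1 s2 t1 t2; rewrite ge0_fin_numE ?vsum_ge0//.
  apply: (@le_lt_trans _ _ (vlen f a c)); last by rewrite ltey.
  by apply: le_trans (key _ _ s1 s2 t1 t2); rewrite leeDl// vsum_ge0.
have bF : vlen f b c \is a fin_num.
  rewrite ge0_fin_numE ?vlen_ge0//.
  apply: (@le_lt_trans _ _ (vlen f a c)); last by rewrite ltey.
  apply: vlen_leP => t t1 t2.
  have /= := key [:: b] t _ erefl t1 t2; rewrite ab => /(_ isT).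
  by apply: le_trans; rewrite leeDr// adde_ge0.
rewrite -leeBrDr//; apply: vlen_leP => s s1 s2; rewrite leeBrDr//.
have sfin : vsum f a s \is a fin_num by apply: (sF s [:: c]) => //=; rewrite bc.
by rewrite addeC -leeBrDr//; apply: vlen_leP => t t1 t2; rewrite leeBrDr// addeC key.
Qed.

Lemma vsum_insert f a b s : path <=%R a s -> a <= b -> b <= last a s ->
  exists s1 s2, [/\ path <=%R a s1, last a s1 = b, path <=%R b s2,
    last b s2 = last a s & (vsum f a s <= vsum f a s1 + vsum f b s2)%E].
Proof.
elim: s a => [|x s ih] a /=.
  move=> _ ab ba; exists [::], [::]; split => //=; last by rewrite adde0.
  by apply/eqP; rewrite eq_le ab ba.
  by apply/eqP; rewrite eq_le ab ba.
move=> /andP[ax xs] ab bl; have [bx|xb] := leP b x.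
  exists [:: b], (x :: s); split => //=; rewrite ?ab ?bx//.
  by rewrite adde0 addeA leeD2r.
have [s1 [s2 [h1 h2 h3 h4 h5]]] := ih _ xs (ltW xb) bl.
exists (x :: s1), s2; split => //=; first by rewrite ax.
by rewrite -addeA leeD2l.
Qed.

Lemma vlenD f a b c : a <= b -> b <= c ->
  vlen f a c = (vlen f a b + vlen f b c)%E.
Proof.
move=> ab bc; apply/eqP; rewrite eq_le vlen_split// andbT.
apply: vlen_leP => s sP sc.
have [||s1 [s2 [h1 h2 h3 h4]]] := vsum_insert (b := b) f sP => //.
  by rewrite sc.
move=> /le_trans; apply; apply: leeD.
  by rewrite -h2 vsum_le_vlen.
by rewrite -sc -h4 vsum_le_vlen.
Qed.

Lemma vlenxx f a : vlen f a a = 0%E.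
Proof.
apply/eqP; rewrite eq_le vlen_ge0// andbT; apply: vlen_leP => s sP sa.
have : forall x, x \in s -> x = a.
  move=> x xs; have : x \in a :: s by rewrite inE xs orbT.
  by move=> /(path_le_mem sP); rewrite sa => h; apply/eqP; rewrite eq_le andbC.
elim: s {sP sa} => //= b s ih h.
have -> : b = a by apply: h; rewrite inE eqxx.
by rewrite d0 add0e; apply: ih => x xs; apply: h; rewrite inE xs orbT.
Qed.

Lemma vlenS f a b a' b' : a <= a' -> a' <= b' -> b' <= b ->
  (vlen f a' b' <= vlen f a b)%E.
Proof.
move=> aa ab bb; rewrite (@vlenD f a a' b) ?(@vlenD f a' b' b)//.
  by rewrite addeCA leeDl// adde_ge0// vlen_ge0.
exact: le_trans bb.
Qed.

Lemma path_lengthE f : path_length d f = vlen f 0 1.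
Proof.
have sumE s a def : \sum_(0 <= k < size s)
    d (f (nth def (a :: s) k)) (f (nth def s k)) = vsum f a s :> \bar K.
  elim: s a => [|b s ih] a /=; first by rewrite big_geq.
  by rewrite big_nat_recl//= ih.
apply/eqP; rewrite eq_le; apply/andP; split.
  apply: ge_ereal_sup => _ [s [s1 /eqP s2] <-].
  rewrite sumE -[X in vlen f 0 X]s2; apply: vsum_le_vlen.
  by apply: sub_path s1 => x y; exact: ltW.
apply: vlen_leP => s sP sl; apply: ereal_sup_ubound.
have : exists2 t, path <%R 0 t /\ last 0 t = last 0 s & vsum f 0 t = vsum f 0 s.
  elim: s {sl} (0) sP => [|b s ih] a /=; first by exists [::].
  move=> /andP[+ /ih[t [t1 t2] t3]].
  rewrite le_eqVlt => /predU1P[ab|ab].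
    by subst a; rewrite d0 add0e; exists t.
  by exists (b :: t) => /=; rewrite ?ab ?t3.
move=> [t [t1 t2] t3]; exists t; last by rewrite sumE.
by split => //; rewrite t2 sl.
Qed.

(* A chain that almost realizes the length leaves little room for the length
   next to [t]. *)
Lemma vlen_small_right f t c : t < c -> (vlen f t c < +oo)%E ->
  (forall e : K, 0 < e -> exists2 h : K, 0 < h &
     forall s, t <= s <= c -> `|s - t| < h -> (d (f t) (f s) <= e%:E)%E) ->
  forall e : K, 0 < e -> exists2 h : K, 0 < h &
    forall u, t <= u -> u <= c -> `|u - t| < h -> (vlen f t u <= e%:E)%E.
Proof.
move=> tc lfin cf e e0.
have fin x y : t <= x -> x <= y -> y <= c -> vlen f x y \is a fin_num.
  move=> ax xy yb; rewrite ge0_fin_numE ?vlen_ge0//.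
  by apply: le_lt_trans lfin; exact: vlenS.
have e4 : 0 < e / 4 by rewrite divr_gt0.
have := @ub_ereal_sup_adherent K _ _ e4 (fin t c (lexx t) (ltW tc) (lexx c)).
move=> -[_ [s [sP sc] <-] hs].
have [h h0 hh] := cf _ e4.
(* Leading copies of [t] in the chain are skipped until its first point [x] after [t]. For [u]
   between [t] and [x], inserting [u] splits off the small distance from [f t] to [f u] and leaves a
   chain that starts at [u]. *)
have : exists2 h', 0 < h' & forall u, t <= u -> u <= c -> u - t < h' ->
  (vsum f t s <= (e / 2)%:E + vlen f u c)%E.
  elim: s sP sc {hs} => [|x s ih] /=; first by move=> _ tc'; rewrite tc' ltxx in tc.
  move=> /andP[tx xs] sc.
  move: tx; rewrite le_eqVlt => /predU1P[tx|tx].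
    subst x; have [h' h'0 H] := ih xs sc.
    by exists h' => // u *; rewrite d0 add0e; exact: H.
  exists (Num.min h (x - t)); first by rewrite lt_min h0 subr_gt0.
  move=> u tu uc; rewrite lt_min => /andP[uh ux].
  apply: (@le_trans _ _ ((d (f t) (f u) + d (f u) (f x)) + vsum f x s)%E).
    exact: leeD2r.
  rewrite -addeA; apply: leeD.
    have /le_trans -> // : (d (f t) (f u) <= (e / 4)%:E)%E.
      by apply: hh; rewrite ?tu// ger0_norm// subr_ge0.
    by rewrite lee_fin; lra.
  rewrite (_ : (_ + _)%E = vsum f u (x :: s))//.
  have -> : c = last u (x :: s) by rewrite /= sc.
  by apply: vsum_le_vlen => /=; rewrite xs andbT; lra.
move=> [h' h'0 H]; exists h' => // u tu uc; rewrite ger0_norm ?subr_ge0// => uh'.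
have := H _ tu uc uh'.
move: hs; rewrite -[ereal_sup _]/(vlen f t c) (@vlenD f t u c)//.
have F1 : vlen f t u \is a fin_num by apply: fin.
have F2 : vlen f u c \is a fin_num by apply: fin.
rewrite -(fineK F1) -(fineK F2) => h1 h2.
by have := lt_le_trans h1 h2; rewrite -!EFinD lte_fin lee_fin; lra.
Qed.

(** To the left of [t] the estimate is the one-sided estimate for the reversed path [f \o -%R]. It
    makes arc length continuous, so that a path can be cut at a prescribed length. *)
Lemma vlen_small f a b : a <= b -> (vlen f a b < +oo)%E ->
  (forall t, a <= t <= b -> forall e : K, 0 < e -> exists2 h : K, 0 < h &
     forall s, a <= s <= b -> `|s - t| < h -> (d (f t) (f s) <= e%:E)%E) ->
  forall t, a <= t <= b -> forall e : K, 0 < e -> exists2 h : K, 0 < h &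
    forall s u, a <= s -> s <= t -> t <= u -> u <= b -> `|s - t| < h ->
      `|u - t| < h -> (vlen f s u <= e%:E)%E.
Proof.
move=> ab lfin cf t /[dup] tab /andP[ta tb] e e0.
have e2 : 0 < e / 2 by rewrite divr_gt0.
have [h1 h1_gt0 H1] : exists2 h : K, 0 < h &
    forall u, t <= u -> u <= b -> `|u - t| < h -> (vlen f t u <= (e / 2)%:E)%E.
  have [tb'|tb'] := eqVneq t b.
    exists 1 => // u tu ub _; rewrite (_ : u = t) ?vlenxx ?lee_fin ?ltW//.
    by apply/eqP; rewrite eq_le tu tb' ub.
  apply: vlen_small_right => //; first by rewrite lt_neqAle tb'.
    by apply: le_lt_trans lfin; exact: vlenS.
  move=> e' /(cf t tab)[h h0 H]; exists h => // s /andP[ts sb].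
  by apply: H; rewrite sb (le_trans ta).
have [h2 h2_gt0 H2] : exists2 h : K, 0 < h &
    forall u, a <= u -> u <= t -> `|u - t| < h -> (vlen f u t <= (e / 2)%:E)%E.
  have [ta'|ta'] := eqVneq a t.
    exists 1 => // u tu ub _; rewrite (_ : u = t) ?vlenxx ?lee_fin ?ltW//.
    by apply/eqP; rewrite eq_le ub -{1}ta'.
  have hN : {homo (@GRing.opp K) : x y / y <= x >-> x <= y}.
    by move=> x y; rewrite lerN2.
  have [|||h h0 H] := @vlen_small_right (f \o -%R) (- t) (- a) _ _ _ _ e2.
  - by rewrite ltrN2 lt_neqAle ta'.
  - apply: (le_lt_trans (vlen_anti _ _ _ hN)); rewrite !opprK.
    by apply: le_lt_trans lfin; exact: vlenS.
  - move=> e' /(cf t tab)[h h0 H]; exists h => // s /andP[ts sb].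
    rewrite /= opprK => st; apply: H.
      by rewrite lerNr sb/= lerNl (le_trans _ ts)// lerN2.
    by rewrite -normrN opprD !opprK.
  exists h => // u au ut uth.
  rewrite (_ : vlen f u t = vlen ((f \o -%R) \o -%R) u t); last first.
    by apply: eq_vlen => s _ /=; rewrite opprK.
  apply: (le_trans (vlen_anti _ _ _ hN)).
  by apply: H; rewrite ?lerN2// -opprD normrN.
exists (Num.min h1 h2); first by rewrite lt_min h1_gt0.
move=> s u sa st tu ub; rewrite !lt_min => /andP[_ sh] /andP[uh _].
rewrite (vlenD _ st tu) (splitr e) EFinD.
by apply: leeD; [apply: H2|apply: H1].
Qed.

End PathLength.

(** * Path metrics *)

Section RealContinuity.
Context {K : realType}.

Lemma cont_on_real (a b : K) (f : K -> K) :
  (forall t, a <= t <= b -> forall e : K, 0 < e -> exists2 h : K, 0 < h &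
     forall s, a <= s <= b -> `|s - t| < h -> `|f s - f t| <= e) ->
  cont_on a b f.
Proof.
move=> H t tab W oW Wt.
have : nbhs (f t) W by apply: open_nbhs_nbhs.
move=> [e /= e0 eW].
have e2 : 0 < e / 2 by rewrite divr_gt0.
have [h h0 hH] := H t tab _ e2.
exists h => // s sab st; apply: eW => /=; rewrite distrC.
by apply: (le_lt_trans (hH s sab st)); lra.
Qed.

Lemma cont_on_IVT (a b v : K) (f : K -> K) : a <= b -> cont_on a b f ->
  f a <= v <= f b -> exists2 c, a <= c <= b & f c = v.
Proof.
move=> ab /within_itvP cf /andP[av vb].
have [|c cab fc] := IVT ab cf (v := v).
  by rewrite ge_min av/= le_max vb orbT.
by exists c => //; move: cab; rewrite in_itv.
Qed.

End RealContinuity.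

Section PathMetric.
Context {K : realType} (T : topologicalType) (W : Type) (d : W -> W -> \bar K).
Hypothesis d_epm : is_epseudometric setT d.
Variables (h : T -> W) (A : set T).

(* Both [intrinsic_dist] and [lift_dist] are of this form. *)
Definition path_dist (x y : T) : \bar K :=
  ereal_inf [set path_length d (h \o f)
            | f in [set f | is_path x y f /\ f @` `[0, 1] `<=` A]].

Lemma is_pathP (S : topologicalType) (x y : S) (f : K -> S) :
  is_path x y f <-> [/\ cont_on 0 1 f, f 0 = x & f 1 = y].
Proof. by split => -[cf f0 f1]; split => //; apply/within_itvP. Qed.

Lemma path_dist_le_vlen (f : K -> T) a b : a <= b -> cont_on a b f ->
  (forall t, a <= t <= b -> A (f t)) ->
  (path_dist (f a) (f b) <= vlen d (h \o f) a b)%E.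
Proof.
move=> ab cf fA; pose g t := f (a + (b - a) * t).
have hab t : 0 <= t <= 1 -> a <= a + (b - a) * t <= b.
  by move=> /andP[t0 t1]; apply/andP; split; nra.
apply: (@le_trans _ _ (path_length d (h \o g))).
  apply: ereal_inf_lbound; exists g => //; split.
    apply/is_pathP; split.
    - exact: cont_on_affine cf _ _ hab.
    - by rewrite /g mulr0 addr0.
    - by rewrite /g mulr1 addrC subrK.
  by move=> _ [t t01 <-]; apply/fA/hab; move: t01; rewrite /= in_itv.
rewrite path_lengthE//.
have := @vlen_mono K W d (h \o f) (fun t => a + (b - a) * t) 0 1.
rewrite mulr0 addr0 mulr1 (addrC a) subrK; apply.
by move=> x y xy; rewrite lerD2l ler_wpM2l// subr_ge0.
Qed.

Lemma path_dist_lt_path x y r : (path_dist x y < r)%E -> exists f : K -> T,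
  [/\ cont_on 0 1 f, f 0 = x, f 1 = y, forall t, 0 <= t <= 1 -> A (f t) &
      (vlen d (h \o f) 0 1 < r)%E].
Proof.
move=> /ereal_inf_lt[_ [f [/is_pathP[cf f0 f1] fA] <-]].
rewrite path_lengthE// => fr; exists f; split => // t t01.
by apply: fA; exists t => //=; rewrite in_itv.
Qed.

Lemma path_dist_ge0 x y : (0 <= path_dist x y)%E.
Proof.
apply: le_ereal_inf_tmp => _ [f _ <-]; rewrite path_lengthE//.
exact: vlen_ge0.
Qed.

Lemma path_dist_ge x y : (d (h x) (h y) <= path_dist x y)%E.
Proof.
apply: le_ereal_inf_tmp => _ [f [/is_pathP[_ <- <-] _] <-].
rewrite path_lengthE//.
exact: (vlen_dist d (h \o f) ler01).
Qed.

Lemma path_distxx x : A x -> path_dist x x = 0%E.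
Proof.
move=> Ax; apply/eqP; rewrite eq_le path_dist_ge0 andbT.
have := @path_dist_le_vlen (fun=> x) 0 0 (lexx _) (@cont_on_cst _ _ 0 0 x).
by rewrite vlenxx//; apply.
Qed.

Lemma path_dist_sym_le x y : (path_dist x y <= path_dist y x)%E.
Proof.
apply: le_ereal_inf_tmp => _ [f [/is_pathP[cf <- <-] fA] <-].
rewrite path_lengthE//.
have h01 (t : K) : 0 <= t <= 1 -> 0 <= 1 + -1 * t <= 1 by lra.
have := @path_dist_le_vlen (fun t => f (1 + -1 * t)) 0 1 ler01
  (@cont_on_affine _ _ _ _ _ _ _ cf 0 1 h01).
rewrite mulr0 addr0 mulr1 subrr => H; apply: (le_trans (H _)).
  by move=> t /h01 t01; apply: fA; exists (1 + -1 * t) => //=; rewrite in_itv.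
have := @vlen_anti K W d d_epm (h \o f) (fun t => 1 + -1 * t) 0 1.
by rewrite mulr0 addr0 mulr1 subrr; apply => u v; lra.
Qed.

Lemma path_distC x y : path_dist x y = path_dist y x.
Proof. by apply/eqP; rewrite eq_le !path_dist_sym_le. Qed.

Lemma path_dist_triangle x y z : (path_dist x z <= path_dist x y + path_dist y z)%E.
Proof.
have [->|xy] := eqVneq (path_dist x y) +oo%E.
  by rewrite addye ?leey// gt_eqF// (lt_le_trans _ (path_dist_ge0 _ _))// ltNyr.
have [->|yz] := eqVneq (path_dist y z) +oo%E.
  by rewrite addey ?leey// gt_eqF// (lt_le_trans _ (path_dist_ge0 _ _))// ltNyr.
have xyF : path_dist x y \is a fin_num by rewrite ge0_fin_numE ?path_dist_ge0// ltey.
have yzF : path_dist y z \is a fin_num by rewrite ge0_fin_numE ?path_dist_ge0// ltey.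
apply/lee_addgt0Pr => e e0.
have e2 : 0 < e / 2 by rewrite divr_gt0.
have /path_dist_lt_path[f [cf f0 f1 fA fl]] : (path_dist x y < path_dist x y + (e / 2)%:E)%E.
  by rewrite lteDl// lte_fin.
have /path_dist_lt_path[g [cg g0 g1 gA gl]] : (path_dist y z < path_dist y z + (e / 2)%:E)%E.
  by rewrite lteDl// lte_fin.
(* The concatenation runs over [0, 2]; [path_dist_le_vlen] takes care of the reparametrization. *)
pose F t := if t <= 1 then f t else g (-1 + 1 * t).
have F1 t : 0 <= t <= 1 -> f t = F t by rewrite /F => /andP[_ ->].
have F2 t : 1 <= t <= 2 -> g (-1 + 1 * t) = F t.
  rewrite /F => /andP[t1 _]; case: ifPn => // t1'.
  by have -> : t = 1; [lra|rewrite mulr1 addNr g0 f1].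
have h12 (t : K) : 1 <= t <= 2 -> 0 <= -1 + 1 * t <= 1 by lra.
have c1 : cont_on 0 1 F by exact: cont_on_ext F1 cf.
have c2 : cont_on 1 2 F by apply: cont_on_ext F2 _; exact: cont_on_affine cg _ _ h12.
have cF := cont_on_glue c1 c2.
have := @path_dist_le_vlen F 0 2 ltac:(lra) cF.
have -> : F 0 = x by rewrite -F1 ?lexx ?ler01.
have -> : F 2 = z.
  by rewrite -F2 ?lexx ?ler1n// (_ : -1 + 1 * 2 = 1) ?g1//; ring.
move=> H; apply: (le_trans (H _)).
  move=> t /andP[t0 t2]; have [t1|t1] := leP t 1.
    by rewrite -F1 ?t0//; apply: fA; rewrite t0.
  by rewrite -F2 ?t2 ?ltW//; apply/gA/h12; rewrite t2 ltW.
rewrite (@vlenD K W d d_epm (h \o F) 0 1 2) ?ler01 ?ler1n//.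
rewrite (splitr e) EFinD addeACA; apply: leeD.
  rewrite -(@eq_vlen K W d (h \o f)); first exact: ltW.
  by move=> t t01 /=; rewrite F1.
rewrite -(@eq_vlen K W d ((h \o g) \o (fun t => -1 + 1 * t))); last first.
  by move=> t t01 /=; rewrite F2.
apply: le_trans (ltW gl).
have := @vlen_mono K W d (h \o g) (fun t => -1 + 1 * t) 1 2.
rewrite mulr1 addNr (_ : -1 + 1 * 2 = 1 :> K); last by ring.
by apply => u v; lra.
Qed.

Lemma path_dist_epm : is_epseudometric A path_dist.
Proof.
split=> [x Ax|x y _ _|x y _ _|x y z _ _ _].
- exact: path_distxx.
- exact: path_dist_ge0.
- exact: path_distC.
- exact: path_dist_triangle.
Qed.

(** An almost shortest path is cut where its length reaches [t]. The first hypothesis makes the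
    distance continuous along the path, hence also its arc length, and the intermediate value
    theorem applies. If the whole path is no longer than [t], its end [y] serves. *)
Lemma path_dist_intermediate x y (L t : K) :
  (forall x, A x -> forall e : K, 0 < e -> exists2 U : set T, open U /\ U x &
     forall y, U y -> (d (h x) (h y) <= e%:E)%E) ->
  (path_dist x y < L%:E)%E -> 0 <= t <= L ->
  exists m, [/\ A m, (path_dist x m <= t%:E)%E & (path_dist m y <= (L - t)%:E)%E].
Proof.
move=> hc /path_dist_lt_path[f [cf f0 f1 fA fL]] /andP[t0 tL].
pose l u := vlen d (h \o f) 0 u.
have cd u : 0 <= u <= 1 -> forall e : K, 0 < e -> exists2 k : K, 0 < k &
    forall s, 0 <= s <= 1 -> `|s - u| < k ->
      (d ((h \o f) u) ((h \o f) s) <= e%:E)%E.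
  move=> u01 e e0; have [U [oU Uf] UH] := hc _ (fA _ u01) _ e0.
  by have [k k0 kU] := cf u u01 U oU Uf; exists k => // s s01 /(kU s s01)/UH.
have fin u v : 0 <= u -> u <= v -> v <= 1 -> vlen d (h \o f) u v \is a fin_num.
  move=> u0 uv v1; rewrite ge0_fin_numE ?vlen_ge0//.
  apply: (@le_lt_trans _ _ (vlen d (h \o f) 0 1)); first exact: vlenS.
  by rewrite (lt_trans fL)// ltry.
have [lt|tl] := leP (l 1) t%:E.
  exists y; split; first by rewrite -f1; apply: fA; rewrite lexx ler01.
    rewrite -f0 -f1; apply: le_trans lt; exact: path_dist_le_vlen.
  by rewrite path_distxx ?lee_fin ?subr_ge0// -f1; apply: fA; rewrite lexx ler01.
have cl : cont_on 0 1 (fun u => fine (l u)).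
  apply: cont_on_real => u u01 e e0.
  have [|k k0 kH] := vlen_small d_epm ler01 _ cd u01 e0.
    by rewrite (lt_trans fL)// ltry.
  have /andP[u0 u1] := u01.
  have lE a b : 0 <= a -> a <= b -> b <= 1 ->
      fine (l b) - fine (l a) = fine (vlen d (h \o f) a b).
    move=> a0 ab b1; rewrite /l (@vlenD K W d d_epm (h \o f) 0 a b)//.
    rewrite fineD ?fin//; last exact: le_trans b1.
    by rewrite addrC addKr.
  exists k => // s /andP[s0 s1] su; have [s_u|u_s] := leP s u.
    rewrite distrC lE// ger0_norm ?fine_ge0 ?vlen_ge0//.
    by rewrite -lee_fin fineK ?fin//; apply: kH; rewrite ?subrr ?normr0.
  have {}u_s := ltW u_s; rewrite lE// ger0_norm ?fine_ge0 ?vlen_ge0//.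
  by rewrite -lee_fin fineK ?fin//; apply: kH; rewrite ?subrr ?normr0.
have [||c /andP[c0 c1] lc] := cont_on_IVT (v := t) _ cl => //.
  rewrite /l vlenxx// t0/= -lee_fin fineK ?fin ?ler01 ?lexx//.
  exact: ltW.
have lct : l c = t%:E by rewrite -lc fineK ?fin.
exists (f c); split; first by apply: fA; rewrite c0.
  rewrite -f0 -lct; apply: path_dist_le_vlen => //; first exact: cont_onW cf.
  by move=> u /andP[u0 uc]; apply: fA; rewrite u0 (le_trans uc).
rewrite -f1; apply: (@le_trans _ _ (vlen d (h \o f) c 1)).
  apply: path_dist_le_vlen => //; first exact: cont_onW cf.
  by move=> u /andP[u0 uc]; apply: fA; rewrite uc (le_trans _ u0).
rewrite EFinB leeBrDr// addeC -lct -vlenD//; exact: ltW.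
Qed.

End PathMetric.

Section Instances.
Context {K : realType}.

Lemma emdist_epm (M : metricType K) : is_epseudometric setT (@emdist K M).
Proof.
split=> [x _|x y _ _|x y _ _|x y z _ _ _]; rewrite /emdist.
- by rewrite mdistxx.
- by rewrite lee_fin mdist_ge0.
- by rewrite metric_sym.
- by rewrite -EFinD lee_fin metric_triangle.
Qed.

Lemma lift_distE (T : Type) (d : T -> T -> \bar K) (E : topologicalType)
    (f : E -> edist_space d) : lift_dist d f = path_dist d f setT.
Proof.
apply/funext => x; apply/funext => y; congr ereal_inf.
apply/seteqP; split=> _ [a ha <-]; exists a => //.
by case: ha => + _; exact.
Qed.

End Instances.

(** * Covering spaces *)

Section Coverings.
Context {K : realType} (E Z : topologicalType) (f : E -> Z).
Hypothesis f_cov : is_covering_map f.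

Let cf : continuous f. Proof. by case: f_cov. Qed.

(* [s] is the local inverse of [f] with values in the sheet [V] over [U]. *)
Definition is_sheet (U : set Z) (V : set E) (s : Z -> E) : Prop :=
  [/\ open V, forall u, U u -> V (s u) /\ f (s u) = u,
      forall v, V v -> s (f v) = v,
      forall W, open W -> open (U `&` s @^-1` W) &
      forall (a b : K) (c : K -> E), a <= b -> cont_on a b c ->
        (forall t, a <= t <= b -> U (f (c t))) -> V (c a) -> V (c b)].

Lemma sheetP z : exists U : set Z, [/\ open U, U z &
  forall x, U (f x) -> exists V s, is_sheet U V s /\ V x].
Proof.
have [_ _ /(_ z)[U [oU Uz [F [UF tF FP]]]]] := f_cov.
exists U; split => // x Ux.
have [V FV Vx] : (\bigcup_(V in F) V) x by rewrite -UF.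
have [oV injV fV Vo] := FP V FV.
(* Over [U] the fibre in [V] is a single point; outside [U] the value is the junk default [x]. *)
pose s u := xget x [set v | V v /\ f v = u].
have sP u : U u -> V (s u) /\ f (s u) = u.
  rewrite -fV => -[v Vv <-].
  by apply: (@xgetI _ x [set w | V w /\ f w = f v] v).
have sK v : V v -> s (f v) = v.
  move=> Vv; have [|h1 h2] := sP (f v); first by rewrite -fV; exists v.
  by apply: injV => //; exact: mem_set.
exists V, s; split => //; split => //.
  move=> W oW; rewrite (_ : _ `&` _ = f @` (V `&` W)).
    by apply: Vo; [exact: openI|move=> w []].
  apply/seteqP; split=> [u [Uu Wu]|_ [v [Vv Wv] <-]].
    by have [h1 h2] := sP u Uu; exists (s u).
  by split; [rewrite -fV; exists v|rewrite /= sK].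
(* The sheets are open and pairwise disjoint, so the sheet of [c t] contains all of [c] near [t]: a
   path over [U] cannot change its sheet. *)
move=> a b c ab cc cU.
apply: (cousin (Q := fun s t => V (c s) -> V (c t)) ab).
  by move=> ? ? ? _ _ _ _ h1 h2 /h1.
move=> t tab.
have [V' FV' V't] : (\bigcup_(V in F) V) (c t) by rewrite -UF; exact: cU.
have [oV' _ _ _] := FP V' FV'.
have [e e0 eV'] := cc t tab V' oV' V't.
exists e => // p q ap pt tq qb pte qte Vp.
have <- : V' = V; last by apply: eV' => //; rewrite qb (le_trans ap)// (le_trans pt).
apply: tF => //; exists (c p); split => //; apply: eV' => //.
by rewrite ap (le_trans pt)// (le_trans tq).
Qed.

Lemma sheet_cont U V s a b g : is_sheet U V s -> cont_on a b g ->
  (forall t, a <= t <= b -> U (g t)) -> cont_on (a : K) b (s \o g).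
Proof.
move=> [_ _ _ so _] cg gU t tab W oW Wt.
have [e e0 eW] := cg t tab _ (so W oW) (conj (gU t tab) Wt).
by exists e => // r rab rt; have [] := eW r rab rt.
Qed.

(** The property given to [cousin] quantifies over all starting points, so that the lift over the
    second of two adjacent intervals can start where the first one ended. Over a short interval the
    lift is a local inverse composed with [g]. *)
Lemma path_lift (a b : K) g : a <= b -> cont_on a b g ->
  forall e, f e = g a ->
  exists c, [/\ cont_on a b c, c a = e & forall t, a <= t <= b -> f (c t) = g t].
Proof.
move=> ab cg.
apply: (cousin (Q := fun s t => forall e, f e = g s ->
  exists c, [/\ cont_on s t c, c s = e &
    forall r, s <= r <= t -> f (c r) = g r]) ab).
  move=> s t u _ st tu _ h1 h2 e fe.
  have [c [cc cs fc]] := h1 e fe.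
  have [|c' [cc' cs' fc']] := h2 (c t); first by rewrite fc// st lexx.
  exists (fun r => if r <= t then c r else c' r); split.
  - apply: (@cont_on_glue _ _ s t u).
      by apply: cont_on_ext cc => r /andP[_ ->].
    apply: cont_on_ext cc' => r /andP[tr _]; case: ifPn => // rt.
    by have -> : r = t by apply/eqP; rewrite eq_le rt tr.
  - by rewrite st.
  - move=> r /andP[sr ru]; case: ifPn => [rt|]; first by rewrite fc// sr.
    by rewrite -ltNge => /ltW tr; rewrite fc'// tr.
move=> t tab; have [U [oU Ut UP]] := sheetP (g t).
have [h h0 hU] := cg t tab U oU Ut.
exists h => // s u as_ st tu ub sth uth e fe.
have gU r : s <= r <= u -> U (g r).
  move=> /andP[sr ru]; apply: hU; first by rewrite (le_trans as_)// (le_trans ru).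
  move: sth uth; rewrite !ltr_norml => /andP[+ _] /andP[_]; lra.
have Ue : U (f e) by rewrite fe; apply: gU; rewrite lexx (le_trans st).
have [V [sg [sV Ve]]] := UP e Ue.
exists (sg \o g); split.
- by apply: sheet_cont sV _ gU; exact: cont_onW cg.
- by rewrite /= -fe; case: sV => _ _ + _ _; apply.
- by move=> r sru /=; case: sV => _ /(_ (g r) (gU r sru))[].
Qed.

Lemma lift_unique (a b : K) (c c' : K -> E) : a <= b ->
  cont_on a b c -> cont_on a b c' ->
  (forall t, a <= t <= b -> f (c t) = f (c' t)) -> c a = c' a -> c b = c' b.
Proof.
move=> ab cc cc' ff.
apply: (cousin (Q := fun s t => c s = c' s -> c t = c' t) ab).
  by move=> ? ? ? _ _ _ _ h1 h2 /h1.
move=> t tab; have [U [oU Ut UP]] := sheetP (f (c t)).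
have [h h0 hU] := cont_on_comp cf cc tab oU Ut.
exists h => // s u as_ st tu ub sth uth cs.
have gU r : s <= r <= u -> U (f (c r)).
  move=> /andP[sr ru]; apply: hU; first by rewrite (le_trans as_)// (le_trans ru).
  move: sth uth; rewrite !ltr_norml => /andP[+ _] /andP[_]; lra.
have su := le_trans st tu.
have ru_ab r : s <= r <= u -> a <= r <= b.
  by move=> /andP[sr ru]; rewrite (le_trans as_)// (le_trans ru).
have [V [sg [[_ _ sK _ sc] Vs]]] := UP (c s) (gU s ltac:(by rewrite lexx)).
have h1 : V (c u) by apply: (sc s u) => //; exact: cont_onW cc.
have h2 : V (c' u).
  apply: (sc s u) => //; first exact: cont_onW cc'.
    by move=> r sru; rewrite -ff; [exact: gU|exact: ru_ab].
  by rewrite -cs.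
by rewrite -(sK _ h1) -(sK _ h2) ff// ru_ab// su lexx.
Qed.

(** Each path [H ^~ s] is lifted separately, and the end of the lift is shown to be locally constant
    in [s]. Continuity in [s] is carried from time 0 to time 1; then the ends, all over [z1], lie in
    one sheet and agree. *)
Lemma homotopy_lift (H : K -> K -> Z) z1 e :
  (forall t s, 0 <= t <= 1 -> 0 <= s <= 1 -> forall W, open W -> W (H t s) ->
    exists2 h : K, 0 < h & forall t' s', 0 <= t' <= 1 -> 0 <= s' <= 1 ->
      `|t' - t| < h -> `|s' - s| < h -> W (H t' s')) ->
  (forall s, 0 <= s <= 1 -> H 0 s = f e) ->
  (forall s, 0 <= s <= 1 -> H 1 s = z1) ->
  forall c0 c1, cont_on (0 : K) 1 c0 -> cont_on (0 : K) 1 c1 ->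
  c0 0 = e -> c1 0 = e ->
  (forall t, 0 <= t <= 1 -> f (c0 t) = H t 0) ->
  (forall t, 0 <= t <= 1 -> f (c1 t) = H t 1) -> c0 1 = c1 1.
Proof.
move=> cH H0 H1 c0 c1 cc0 cc1 c00 c10 fc0 fc1.
have cHs s : 0 <= s <= 1 -> cont_on 0 1 (H ^~ s).
  move=> s01 t t01 W oW Wt; have [h h0 hW] := cH t s t01 s01 W oW Wt.
  by exists h => // r r01 rt; apply: hW => //; rewrite subrr normr0.
have : forall s, exists c, 0 <= s <= 1 -> [/\ cont_on 0 1 c, c 0 = e &
    forall t, 0 <= t <= 1 -> f (c t) = H t s].
  move=> s; have [s01|] := boolP (0 <= s <= 1); last by exists (fun=> e).
  have [c cP] := path_lift ler01 (cHs s s01) (esym (H0 s s01)).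
  by exists c.
move=> /choice[C CP].
have b0 : 0 <= (0 : K) <= 1 by rewrite lexx ler01.
have b1 : 0 <= (1 : K) <= 1 by rewrite lexx ler01.
have -> : c0 1 = C 0 1.
  have [h1 h2 h3] := CP 0 b0.
  by apply: (lift_unique ler01 cc0 h1) => [t t01|]; rewrite ?h3 ?fc0// c00.
have -> : c1 1 = C 1 1.
  have [h1 h2 h3] := CP 1 b1.
  by apply: (lift_unique ler01 cc1 h1) => [t t01|]; rewrite ?h3 ?fc1// c10.
apply: (cousin (Q := fun s u => C s 1 = C u 1) ler01).
  by move=> ? ? ? _ _ _ _ -> ->.
move=> s0 s001; have [C0 C00 fC0] := CP s0 s001.
(* Continuity at [s0] of the lifts taken at time [t]. It is trivial at time 0, where all lifts start
   at [e], and spreads along any time interval during which [H] stays in an evenly covered set. *)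
pose P t := forall W, open W -> W (C s0 t) -> exists2 h : K, 0 < h &
  forall s, 0 <= s <= 1 -> `|s - s0| < h -> W (C s t).
have : P 1.
  have : P 0.
    move=> W oW; rewrite C00 => We; exists 1 => // s s01 _.
    by have [_ -> _] := CP s s01.
  apply: (cousin (Q := fun t u => P t -> P u) ler01).
    by move=> ? ? ? _ _ _ _ h1 h2 /h1.
  move=> t t01; have [U [oU Ut UP]] := sheetP (H t s0).
  have [h h0 hU] := cH t s0 t01 s001 U oU Ut.
  exists h => // t1 t2 t1a t1t tt2 t2b t1h t2h Pt1 W oW Wt2.
  have t12 := le_trans t1t tt2.
  have tU r s : t1 <= r <= t2 -> 0 <= s <= 1 -> `|s - s0| < h -> U (H r s).
    move=> /andP[sr ru] s01 ss; apply: hU => //.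
      by rewrite (le_trans t1a)// (le_trans ru).
    move: t1h t2h; rewrite !ltr_norml => /andP[+ _] /andP[_]; lra.
  have t01' r : t1 <= r <= t2 -> 0 <= r <= 1.
    by move=> /andP[sr ru]; rewrite (le_trans t1a)// (le_trans ru).
  have [] := UP (C s0 t1).
    rewrite fC0; last by apply: t01'; rewrite lexx.
    by apply: tU; rewrite ?lexx// subrr normr0.
  move=> V [sg [[oV sgP sK so sc] Vx]].
  have [h' h'0 hV] := Pt1 V oV Vx.
  have CV s : 0 <= s <= 1 -> `|s - s0| < h -> `|s - s0| < h' ->
      C s t2 = sg (H t2 s).
    move=> s01 ss ss'; have [h1 h2 h3] := CP s s01.
    rewrite -h3 ?sK//; last by apply: t01'; rewrite lexx t12.
    apply: (sc t1 t2) => //; first exact: cont_onW h1.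
      by move=> r r12; rewrite h3 ?t01'//; exact: tU.
    exact: hV.
  have Wt : (U `&` sg @^-1` W) (H t2 s0).
    split; first by apply: tU; rewrite ?lexx ?t12// subrr normr0.
    by rewrite /= -CV// subrr normr0.
  have [|k k0 kW] := cH t2 s0 _ s001 _ (so W oW) Wt.
    by apply: t01'; rewrite lexx t12.
  exists (Num.min k (Num.min h h')); first by rewrite !lt_min k0 h0.
  move=> s s01; rewrite !lt_min => /and3P[sk sh sh'].
  rewrite CV//; have [] := kW t2 s _ s01 _ sk => //.
    by apply: t01'; rewrite lexx t12.
  by rewrite subrr normr0.
move=> P1; have [U [oU Uz UP]] := sheetP z1.
have fz s : 0 <= s <= 1 -> f (C s 1) = z1.
  by move=> s01; have [_ _ ->//] := CP s s01; exact: H1.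
have [] := UP (C s0 1); first by rewrite fz.
move=> V [sg [[oV sgP sK so sc] Vx]].
have [h h0 hV] := P1 V oV Vx; exists h => // s u a1 a2 a3 a4 sh uh.
have s01 : 0 <= s <= 1 by rewrite a1 (le_trans a2)// (le_trans a3).
have u01 : 0 <= u <= 1 by rewrite a4 (le_trans a1)// (le_trans a2).
by rewrite -(sK _ (hV s s01 sh)) -(sK _ (hV u u01 uh)) !fz.
Qed.

End Coverings.

(** * Path-connected coverings and lifts of lassos *)

Section PathConnected.
Context {K : realType}.

Lemma is_path_cat (T : topologicalType) (x y z : T) (f g : K -> T) :
  is_path x y f -> is_path y z g -> is_path x z (path_cat f g).
Proof.
move=> /is_pathP[cf f0 f1] /is_pathP[cg g0 g1]; apply/is_pathP; split.
- apply: (@cont_on_glue _ _ 0 2^-1 1).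
    apply: cont_on_ext (_ : cont_on 0 2^-1 (fun t => f (0 + 2 * t))).
      by move=> t /andP[t0 t1]; rewrite /path_cat t1 add0r.
    by apply: cont_on_affine cf _ _ _ => t; lra.
  apply: cont_on_ext (_ : cont_on 2^-1 1 (fun t => g (-1 + 2 * t))).
    move=> t /andP[t0 t1]; rewrite /path_cat; case: ifPn => t2.
      have -> : t = 2^-1 by apply/eqP; rewrite eq_le t0 t2.
      by rewrite divff// addNr g0 f1.
    by rewrite addrC.
  by apply: cont_on_affine cg _ _ _ => t; lra.
- by rewrite /path_cat invr_ge0 ler0n mulr0.
- rewrite /path_cat ifF; last by apply/negbTE; rewrite -ltNge; lra.
  by rewrite -g1; congr g; lra.
Qed.

Lemma is_path_rev (T : topologicalType) (x y : T) (f : K -> T) :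
  is_path x y f -> is_path y x (path_rev f).
Proof.
move=> /is_pathP[cf f0 f1]; apply/is_pathP; split.
- apply: cont_on_ext (_ : cont_on 0 1 (fun t => f (1 + -1 * t))).
    by move=> t _; rewrite mulN1r.
  by apply: cont_on_affine cf _ _ _ => t; lra.
- by rewrite /path_rev subr0.
- by rewrite /path_rev subrr.
Qed.

Lemma is_path_comp (S T : topologicalType) (x y : S) (f : K -> S) (g : S -> T) :
  continuous g -> is_path x y f -> is_path (g x) (g y) (g \o f).
Proof.
move=> cg /is_pathP[cf <- <-]; apply/is_pathP; split => //.
exact: cont_on_comp.
Qed.

(** Short paths of the base that stay in an evenly covered set lift into one sheet, so the points
    reachable from [x] form a set that is both open and closed. *)
Lemma covering_path_connected (E Z : topologicalType) (f : E -> Z) :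
  is_covering_map f -> connected [set: E] ->
  (forall z (U : set Z), open U -> U z -> exists U' : set Z, [/\ open U', U' z &
     forall w, U' w -> exists2 g : K -> Z, is_path z w g &
       forall t, 0 <= t <= 1 -> U (g t)]) ->
  forall x y : E, exists c : K -> E, is_path x y c.
Proof.
move=> fcov Econn Zloc x y.
have [cf _ _] := fcov.
have loc v : exists N : set E, [/\ open N, N v & forall w, N w ->
    exists c : K -> E, is_path v w c].
  have [U [oU Uv UP]] := @sheetP K E Z f fcov (f v).
  have [V [s [sV Vv]]] := UP v Uv.
  have [oV _ sK _ _] := sV.
  have [U' [oU' U'v U'P]] := Zloc _ _ oU Uv.
  exists (V `&` f @^-1` U'); split => //.
    by apply: openI => //; apply: open_comp => // ? _; exact: cf.
  move=> w [Vw U'w]; have [g /is_pathP[cg g0 g1] gU] := U'P _ U'w.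
  exists (s \o g); apply/is_pathP; split => /=.
  - exact: sheet_cont sV cg gU.
  - by rewrite g0 sK.
  - by rewrite g1 sK.
have : [set y | exists c : K -> E, is_path x y c] = setT.
  apply: Econn.
  - exists x, (fun=> x); apply/is_pathP; split => //; exact: cont_on_cst.
  - exists [set y | exists c : K -> E, is_path x y c]; last by rewrite setTI.
    rewrite openE => v [c xv]; have [N [oN Nv NP]] := loc v.
    apply: filterS (open_nbhs_nbhs (conj oN Nv)) => w /NP[c' vw].
    by exists (path_cat c c'); exact: is_path_cat xv vw.
  - exists [set y | exists c : K -> E, is_path x y c]; last by rewrite setTI.
    rewrite -openC openE => v xv; have [N [oN Nv NP]] := loc v.
    apply: filterS (open_nbhs_nbhs (conj oN Nv)) => w /NP[c' vw] [c xw].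
    apply: xv; exists (path_cat c (path_rev c')).
    exact: is_path_cat xw (is_path_rev vw).
by move=> /seteqP[_ /(_ y Logic.I)].
Qed.

(* A lift of the lasso around [f \o b] goes out and back along the same path,
   and it ends where it starts. *)
Lemma U_cover_unique (E Z : topologicalType) (U : set (set Z)) (z : Z)
    (f : E -> Z) (b : K -> E) (q q' : E) (V : set Z) :
  @is_U_cover K E Z U z f ->
  (forall x y : E, exists c : K -> E, is_path x y c) ->
  is_path q q' b -> f q = f q' -> U V ->
  (forall t, 0 <= t <= 1 -> V (f (b t))) -> q = q'.
Proof.
move=> [fcov _ [e fe grp]] pc bP fqq UV bV.
have [cf _ _] := fcov.
have [a aP] := pc e q.
pose l := path_cat (path_cat (f \o a) (f \o b)) (path_rev (f \o a)).
have faP : is_path z (f q) (f \o a) by rewrite -fe; exact: is_path_comp.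
have fbP : is_path (f q) (f q) (f \o b) by rewrite {2}fqq; exact: is_path_comp.
have lP : is_path z z l.
  apply: is_path_cat (is_path_rev faP); exact: is_path_cat faP fbP.
have : cover_group U z l.
  apply: cover_group_lasso faP fbP UV _ => _ [t + <-].
  by rewrite /= in_itv => /bV.
move=> /(grp l lP)[c /is_pathP[cc c0 c1] [H [cH Ht0 Ht1 H0s H1s]]].
have /is_pathP[cl l0 l1] := lP.
have [d [cd d0 fd]] := path_lift fcov ler01 cl (etrans fe (esym l0)).
(* [d] lifts the lasso itself, whereas [c] is a closed lift of a homotopic loop. Lifts of homotopic
   paths with a common start have a common end. *)
have d1 : d 1 = e.
  rewrite -c1; apply/esym.
  apply: (homotopy_lift fcov (H := fun t s => H (t, s)) (z1 := z) (e := e)) => //.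
  - move=> t s t01 s01 W oW Wts.
    have ts : (`[0, 1]%classic `*` `[0, 1]%classic) (t, s).
      by split; rewrite /= in_itv.
    move/subspace_continuousP : cH => /(_ (t, s) ts W) [|[A B] [/= [h1 /= h1_gt0 A1] [h2 /= h2_gt0 B2]] AB].
      exact: open_nbhs_nbhs.
    exists (Num.min h1 h2); first by rewrite lt_min h1_gt0.
    move=> t' s' t'01 s'01; rewrite !lt_min => /andP[th _] /andP[_ sh].
    apply: (AB (t', s')); last by split; rewrite /= ?in_itv.
    by split; [apply: A1|apply: B2]; rewrite /= distrC.
  - by move=> s s01; rewrite H0s ?in_itv//= c0.
  - by move=> s s01; rewrite H1s ?in_itv//= c1.
  - by move=> t t01; rewrite Ht0 ?in_itv.
  - by move=> t t01; rewrite fd// Ht1 ?in_itv.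
have /is_pathP[ca a0 a1] := aP; have /is_pathP[cb b0 b1] := bP.
(* The nested [path_cat] runs through [a] on [0, 1/4], through [b] on [1/4, 1/2] and back through
   [a] on [1/2, 1]. *)
have e1 : d 4^-1 = q.
  have h : cont_on 0 1 (fun t => d (0 + 4^-1 * t)).
    by apply: cont_on_affine cd _ _ _ => t; lra.
  have := lift_unique fcov ler01 h ca.
  rewrite mulr0 mulr1 addr0 add0r d0 a0 a1; apply => // t t01.
  rewrite fd; last by lra.
  rewrite /l /path_cat !ifT; [|lra|lra].
  by rewrite /=; congr (f (a _)); lra.
have e2 : d 2^-1 = q'.
  have h : cont_on 0 1 (fun t => d (4^-1 + 4^-1 * t)).
    by apply: cont_on_affine cd _ _ _ => t; lra.
  have := lift_unique fcov ler01 h cb.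
  rewrite mulr0 mulr1 addr0 e1 b0 b1 (_ : 4^-1 + 4^-1 = 2^-1); last by lra.
  apply => // t t01; rewrite fd; last by lra.
  rewrite /l /path_cat ifT; last by lra.
  case: ifPn => t2.
    have -> : t = 0 by lra.
    by rewrite mulr0 addr0 /= mulrA (_ : 2 * 2 / 4 = 1) ?a1 ?b0//; lra.
  by rewrite /=; congr (f (b _)); lra.
(* Read backwards from its end [e], the last half of [d] is a lift of [f \o a], hence is [a]; so [d]
   is at [q] at time 1/2, where it was found to be at [q']. *)
have h : cont_on 0 1 (fun t => d (1 + - 2^-1 * t)).
  by apply: cont_on_affine cd _ _ _ => t; lra.
have := lift_unique fcov ler01 h ca.
rewrite mulr0 mulr1 addr0 d1 a0 a1 (_ : 1 - 2^-1 = 2^-1); last by lra.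
rewrite e2 => -> // t t01; rewrite fd; last by lra.
rewrite /l /path_cat; case: ifPn => t2.
  have -> : t = 1 by lra.
  rewrite ifF; last by apply/negbTE; rewrite -ltNge; lra.
  rewrite /= a1 fqq -b1; congr (f (b _)); lra.
by rewrite /path_rev /=; congr (f (a _)); lra.
Qed.

End PathConnected.

(** * The intrinsic ball and its relative covers *)

Section EdistSpace.
Context {K : realType} (T : Type) (d : T -> T -> \bar K).
Hypothesis d_epm : is_epseudometric setT d.

Lemma oball_open x (r : K) : open (oball d x r : set (edist_space d)).
Proof.
move=> y; rewrite /oball/= => xy.
have [_ dge0 _ dtri] := d_epm.
have xyF : d x y \is a fin_num.
  by rewrite ge0_fin_numE ?dge0// (lt_trans xy)// ltry.
move: xy; rewrite -(fineK xyF) lte_fin => xy.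
exists (r - fine (d x y)); first by rewrite subr_gt0.
move=> z /= yz; apply: (le_lt_trans (dtri x y z Logic.I Logic.I Logic.I)).
by rewrite -(fineK xyF) -lteBrDl// -EFinB.
Qed.

Lemma oball_center x (r : K) : 0 < r -> oball d x r x.
Proof. by move=> r0; rewrite /oball/=; case: d_epm => -> // _ _ _; rewrite lte_fin. Qed.

End EdistSpace.

(** Comparing each distance with the length of the corresponding piece is enough, because these
    lengths add up. This carries lengths between the manifold, the intrinsic ball and the cover. *)
Lemma vlen_dom {K : realType} (S T : Type) (d : S -> S -> \bar K)
    (d' : T -> T -> \bar K) (f : K -> S) (f' : K -> T) (a b : K) :
  is_epseudometric setT d ->
  (forall u v, a <= u -> u <= v -> v <= b ->
     (d' (f' u) (f' v) <= vlen d f u v)%E) ->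
  (vlen d' f' a b <= vlen d f a b)%E.
Proof.
move=> d_epm H.
have key s c : a <= c -> path <=%R c s -> last c s = b ->
    (vsum d' f' c s <= vlen d f c b)%E.
  elim: s c => [|x s ih] c /= ac.
    by move=> _ cb; rewrite vlen_ge0// cb.
  move=> /andP[cx xs] xb.
  have xb' : x <= b by rewrite -xb; exact: path_le_last.
  rewrite (vlenD d_epm f cx xb'); apply: leeD; first exact: H.
  by apply: ih => //; exact: le_trans cx.
by apply: vlen_leP => s; exact: key.
Qed.

Section IntrinsicBall.
Context {K : realType} (M : metricType K) (p : M) (R : K).
Notation B := (cball (@emdist K M) p R).
Notation Z := (intrinsic_ball p R).
Notation bd := (@ball_dist K M p R).

Let em_epm := @emdist_epm K M.

Lemma ball_distE (x y : Z) :
  bd x y = path_dist (@emdist K M) id B (to_space x) (to_space y).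
Proof. by []. Qed.

Lemma to_space_cball (x : Z) : B (to_space x).
Proof. exact: set_valP. Qed.

Lemma ball_dist_epm : is_epseudometric [set: Z] bd.
Proof.
split=> [x _|x y _ _|x y _ _|x y z _ _ _]; rewrite !ball_distE.
- by rewrite path_distxx//; exact: to_space_cball.
- exact: path_dist_ge0.
- exact: path_distC.
- exact: path_dist_triangle.
Qed.

(* [h] is continuous for the finer, intrinsic topology because short pieces of
   [g] have small length. *)
Lemma rectifiable_path (g : K -> M) : cont_on 0 1 g ->
  (forall t, 0 <= t <= 1 -> B (g t)) -> (vlen (@emdist K M) g 0 1 < +oo)%E ->
  exists h : K -> Z, [/\ cont_on 0 1 h,
    forall t, 0 <= t <= 1 -> to_space (h t) = g t &
    forall a b, 0 <= a -> a <= b -> b <= 1 ->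
      (vlen bd h a b <= vlen (@emdist K M) g a b)%E].
Proof.
move=> cg gB gl.
have B0 : B (g 0) by apply: gB; rewrite lexx ler01.
(* Outside [0, 1] the path may leave the ball; the value there is a junk default. *)
pose h t : Z := if pselect (B (g t)) is left Bt then exist _ (g t) (mem_set Bt)
  else exist _ (g 0) (mem_set B0).
have hE t : 0 <= t <= 1 -> to_space (h t) = g t.
  by move=> t01; rewrite /h; case: pselect => // /(_ (gB t t01)).
have hd a b : 0 <= a -> a <= b -> b <= 1 ->
    (bd (h a) (h b) <= vlen (@emdist K M) g a b)%E.
  move=> a0 ab b1; rewrite ball_distE !hE ?a0 ?b1 ?(le_trans ab)//; last first.
    by rewrite (le_trans a0).
  apply: (@path_dist_le_vlen K M M _ em_epm id) => //; first exact: cont_onW cg.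
  by move=> t /andP[ta tb]; apply: gB; rewrite (le_trans a0)// (le_trans tb).
exists h; split => //; last first.
  move=> a b a0 ab b1; apply: vlen_dom => // u v au uv vb.
  by apply: hd => //; [exact: le_trans au|exact: le_trans b1].
move=> t /[dup] t01 /andP[t0 t1] W oW /(oW _)[e e0 eW].
have small u : 0 <= u <= 1 -> forall e : K, 0 < e -> exists2 k : K, 0 < k &
    forall s, 0 <= s <= 1 -> `|s - u| < k -> (emdist (g u) (g s) <= e%:E)%E.
  move=> u01 k k0.
  have [] := cg u u01 (ball (g u) k)^°.
  - exact: open_interior.
  - exact: nbhsx_ballx.
  move=> k' k'0 kW; exists k' => // s s01 su.
  have /interior_subset := kW s s01 su.
  by rewrite ballEmdist /= /emdist lee_fin => /ltW.
have e2 : 0 < e / 2 by rewrite divr_gt0.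
have [k k0 kH] := vlen_small em_epm ler01 gl small t01 e2.
exists k => // s /andP[s0 s1] st; apply: eW.
apply: (@le_lt_trans _ _ (e / 2)%:E); last by rewrite lte_fin; lra.
have [st'|ts] := leP s t.
  have [_ _ dC _] := ball_dist_epm; rewrite dC//.
  apply: (le_trans (hd s t s0 st' t1)); apply: kH => //.
  by rewrite subrr normr0.
have {}ts := ltW ts.
apply: (le_trans (hd t s t0 ts s1)); apply: kH => //.
by rewrite subrr normr0.
Qed.

(** The intrinsic metric is a length metric for its own topology: a short path of [M] remains
    continuous for the finer topology and does not become longer. *)
Lemma ball_dist_lt_path (x y : Z) (e : \bar K) : (bd x y < e)%E ->
  exists h : K -> Z, is_path x y h /\ (vlen bd h 0 1 < e)%E.
Proof.
rewrite ball_distE => /(path_dist_lt_path em_epm)[g [cg g0 g1 gB gl]].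
have [|h [ch hg hl]] := rectifiable_path cg gB.
  by rewrite (lt_le_trans gl)// leey.
exists h; split; last first.
  by apply: le_lt_trans gl; apply: hl.
apply/is_pathP; split => //; apply: val_inj => /=.
  by rewrite -[LHS]/(to_space (h 0)) hg ?lexx ?ler01.
by rewrite -[LHS]/(to_space (h 1)) hg ?lexx ?ler01.
Qed.

Lemma path_oball (x y : Z) h e : is_path x y h -> (vlen bd h 0 1 < e%:E)%E ->
  forall t, 0 <= t <= 1 -> oball bd x e (h t).
Proof.
move=> /is_pathP[ch <- _] he t /andP[t0 t1]; rewrite /oball/=.
apply: (le_lt_trans (vlen_dist bd h t0)).
by apply: le_lt_trans he; apply: vlenS => //; exact: ball_dist_epm.
Qed.

Lemma intrinsic_ball_lpc (z : Z) (U : set Z) : open U -> U z ->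
  exists U' : set Z, [/\ open U', U' z &
     forall w, U' w -> exists2 g : K -> Z, is_path z w g &
       forall t, 0 <= t <= 1 -> U (g t)].
Proof.
move=> oU /(oU _)[e e0 eU]; exists (oball bd z e); split.
- exact: (oball_open ball_dist_epm).
- exact: (oball_center ball_dist_epm _ e0).
- move=> w /ball_dist_lt_path[h [hP hl]]; exists h => // t t01.
  exact/eU/(path_oball hP).
Qed.

Variables (E : topologicalType) (f : E -> Z).
Hypothesis f_cov : is_covering_map f.

Notation ld := (lift_dist bd f).

Lemma lift_dist_epm : is_epseudometric [set: E] ld.
Proof. rewrite lift_distE; exact: path_dist_epm ball_dist_epm _ _. Qed.

(** The lift metric is compatible with the topology of the cover: a short path within an evenly
    covered ball of the base lifts into one sheet, with the same length. *)
Lemma lift_dist_small x (e : K) : 0 < e -> exists2 U : set E, open U /\ U x &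
  forall y, U y -> (ld x y <= e%:E)%E.
Proof.
move=> e0; have [cf _ _] := f_cov.
have [U [oU Ux UP]] := sheetP (K := K) f_cov (f x).
have [V [s [sV Vx]]] := UP x Ux.
have [oV _ sK _ _] := sV.
have [e' e'0 e'U] := oU _ Ux.
pose e1 := Num.min e e'; have e10 : 0 < e1 by rewrite lt_min e0.
exists (V `&` f @^-1` (oball bd (f x) e1 : set Z)).
  split; last by split => //; exact: (oball_center ball_dist_epm _ e10).
  apply: openI => //; apply: open_comp; first by move=> ? _; exact: cf.
  exact: (oball_open ball_dist_epm).
move=> y [Vy fy].
have [h [hP hl]] := ball_dist_lt_path fy.
have hU t : 0 <= t <= 1 -> U (h t).
  move=> t01; apply: e'U; have := path_oball hP hl t01.
  by rewrite /oball/= => /lt_le_trans; apply; rewrite lee_fin ge_min lexx orbT.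
have /is_pathP[ch h0 h1] := hP.
have := path_dist_le_vlen ball_dist_epm f (A := setT) ler01
  (sheet_cont sV ch hU) (fun _ _ => Logic.I).
rewrite /= h0 h1 !sK// -lift_distE => /le_trans; apply.
rewrite (@eq_vlen _ _ _ _ h).
  by apply: (le_trans (ltW hl)); rewrite lee_fin ge_min lexx.
by move=> t t01 /=; case: sV => _ /(_ (h t) (hU t t01))[_ ->].
Qed.

(** A path shorter than [delta] projects to a loop inside the [delta]-ball around [f q], an element
    of the covering that defines the cover. *)
Lemma lift_unique_short (delta : K) z (q q' : E) :
  is_delta_cover bd delta z f -> f q = f q' -> (ld q q' < delta%:E)%E -> q = q'.
Proof.
move=> fU fqq; rewrite lift_distE => /(path_dist_lt_path ball_dist_epm).
move=> [b [cb b0 b1 _ bl]].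
have pc : forall x y : E, exists c : K -> E, is_path x y c.
  apply: covering_path_connected f_cov _ intrinsic_ball_lpc.
  by case: fU.
have bP : is_path q q' b by apply/is_pathP.
have [cf _ _] := f_cov.
apply: (@U_cover_unique K E Z (delta_balls bd delta) z f b q q' (oball bd (f q) delta)) => //.
  by exists (f q).
by move=> t t01; exact: (path_oball (is_path_comp cf bP)).
Qed.

Variables (r : K) (pt : E).
Hypothesis r_le : r <= R.
Hypothesis pt_in : cball (@emdist K M) p r (to_space (f pt)).

Notation C := (rel_cover f r pt).
Notation rd := (rel_cover_dist f r pt).
Notation rB := (cball (@emdist K M) p r).

Lemma rel_cover_distE : rd = path_dist ld id C.
Proof. by []. Qed.

Lemma rel_cover_dist_epm : is_epseudometric C rd.
Proof. by rewrite rel_cover_distE; exact: path_dist_epm lift_dist_epm _ _. Qed.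

Lemma rel_cover_pt : C pt.
Proof. exact: connected_component_refl. Qed.

Lemma rel_coverP x : C x -> rB (to_space (f x)).
Proof. by move=> /connected_component_sub. Qed.

Lemma rel_cover_intermediate x y (L t : K) : (rd x y < L%:E)%E -> 0 <= t <= L ->
  exists m, [/\ C m, (rd x m <= t%:E)%E & (rd m y <= (L - t)%:E)%E].
Proof.
rewrite rel_cover_distE; apply: (path_dist_intermediate lift_dist_epm).
by move=> z _ e e0; exact: lift_dist_small.
Qed.

(** A path of B(p, r) is also one of B(p, R), and its lift does not leave the component, since its
    image is connected and lies over B(p, r). Lifting does not lengthen it. *)
Lemma rel_cover_lift x q (e : \bar K) : C x ->
  (intrinsic_dist (@emdist K M) rB (to_space (f x)) q < e)%E ->
  exists y, [/\ C y, to_space (f y) = q & (rd x y < e)%E].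
Proof.
move=> Cx.
rewrite -[intrinsic_dist _ _ _ _]/(path_dist (@emdist K M) id rB _ _).
move=> /(path_dist_lt_path em_epm)[g [cg g0 g1 gB gl]].
have gBR t : 0 <= t <= 1 -> B (g t).
  by move=> /gB; rewrite /cball/= => /le_trans; apply; rewrite lee_fin.
have [|h [ch hg hl]] := rectifiable_path cg gBR.
  by rewrite (lt_le_trans gl)// leey.
have fx : f x = h 0.
  apply: val_inj; rewrite -[RHS]/(to_space (h 0)) hg ?lexx ?ler01//.
have [c [cc c0 fc]] := path_lift f_cov ler01 ch fx.
have cC t : 0 <= t <= 1 -> C (c t).
  move=> t01; apply: (connected_component_trans Cx).
  exists (c @` `[0, 1]); last by exists t => //=; rewrite in_itv.
  split.
  - by exists 0; rewrite //= in_itv/= lexx ler01.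
  - move=> _ [u + <-]; rewrite /= in_itv => u01.
    by rewrite fc// hg//; exact: gB.
  - apply: connected_continuous_connected; first exact: segment_connected.
    exact/within_itvP.
have b1 : 0 <= (1 : K) <= 1 by rewrite lexx ler01.
exists (c 1); split; first exact: cC.
  by rewrite fc// hg// g1.
rewrite -c0 rel_cover_distE.
apply: le_lt_trans gl.
apply: (le_trans (path_dist_le_vlen lift_dist_epm id ler01 cc cC)).
apply: vlen_dom => // u v u0 uv v1.
have uv01 s : u <= s <= v -> 0 <= s <= 1.
  by move=> /andP[us sv]; rewrite (le_trans u0)// (le_trans sv).
rewrite lift_distE.
apply: (le_trans (path_dist_le_vlen ball_dist_epm f uv _ _)) => //.
  exact: cont_onW cc.
apply: le_trans (hl u v u0 uv v1).
by rewrite (@eq_vlen _ _ _ _ h)// => s /uv01 s01 /=; exact: fc.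
Qed.

(* Close to [x], the lift of a point of the base is unique, so that a net of
   the base gives a net with as many points. *)
Lemma rel_cover_net (delta e e' eta : K) (N : nat) (q : nat -> M) :
  is_delta_cover bd delta (f pt) f ->
  (forall y, rB y -> exists2 j, (j < N)%N &
     (intrinsic_dist (@emdist K M) rB (q j) y <= e%:E)%E) ->
  e < e' -> 2 * (eta + e') < delta ->
  forall x, C x -> exists c : nat -> E, (forall j, C (c j)) /\
    forall y, C y -> (rd x y <= eta%:E)%E ->
      exists2 j, (j < N)%N & (rd (c j) y <= e'%:E)%E.
Proof.
move=> fd qP ee' eta_delta x Cx.
have [d0 _ dC dT] := rel_cover_dist_epm.
(* The center [c] is the only lift of [q j] within [eta + e'] of [x]: two of them would be less than
   [delta] apart. If there is none, [x] itself is the default. *)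
have : forall j, exists c, C c /\ forall y, C y -> to_space (f y) = q j ->
    (rd x y <= (eta + e')%:E)%E -> y = c.
  move=> j.
  have [[y [Cy yq xy]]|no] := pselect (exists y, [/\ C y, to_space (f y) = q j &
      (rd x y <= (eta + e')%:E)%E]); last first.
    by exists x; split => // y Cy yq xy; exfalso; apply: no; exists y.
  exists y; split => // y' Cy' y'q xy'.
  apply: (lift_unique_short fd).
    by apply: val_inj; exact: etrans y'q (esym yq).
  apply: (@le_lt_trans _ _ (rd y' y)).
    by rewrite rel_cover_distE; exact: (path_dist_ge lift_dist_epm id).
  apply: (le_lt_trans (dT _ _ _ Cy' Cx Cy)).
  rewrite (dC y' x)//; apply: (le_lt_trans (leeD xy' xy)).
  by rewrite -EFinD lte_fin; lra.
move=> /choice[c cP]; exists c; split; first by move=> j; case: (cP j).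
move=> y Cy xy.
(* A short path from [f y] to the net point [q j] lifts to a path from [y]. Its end [w] is still
   within [eta + e'] of [x], so it is the chosen lift. *)
have [j jN qy] := qP _ (rel_coverP Cy).
have [|w [Cw wq yw]] := rel_cover_lift (q := q j) (e := e'%:E) Cy.
  rewrite -[intrinsic_dist _ _ _ _]/(path_dist (@emdist K M) id rB _ _) path_distC//.
  by apply: (le_lt_trans qy); rewrite lte_fin.
exists j => //; have [_ cj] := cP j; rewrite -(cj w)//.
  by rewrite dC//; exact: ltW.
apply: (le_trans (dT _ _ _ Cx Cy Cw)).
by rewrite EFinD; apply: leeD => //; exact: ltW.
Qed.

End IntrinsicBall.

(** * Ultralimits *)

Section MetricQuotient.
Context {K : realType} (T : Type) (D : T -> T -> K).

Definition is_pseudodist : Prop :=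
  [/\ forall x, D x x = 0, forall x y, D x y = D y x &
      forall y x z, D x z <= D x y + D y z].

(** Points are equivalence classes, encoded as sets, so that distance zero means equality. The proof
    is an argument of the type because the metric structure attached to it depends on that proof. *)
Definition quotient_space (_ : is_pseudodist) : Type :=
  {C : set T | exists x, C = [set y | D x y = 0]}.

Hypothesis D_pseudodist : is_pseudodist.
Notation Q := (quotient_space D_pseudodist).

Let D0 x : D x x = 0. Proof. by case: D_pseudodist. Qed.
Let DC x y : D x y = D y x. Proof. by case: D_pseudodist. Qed.
Let DT y x z : D x z <= D x y + D y z. Proof. by case: D_pseudodist. Qed.

Lemma pseudodist_ge0 x y : 0 <= D x y.
Proof. by have := DT y x x; rewrite D0 (DC y x); lra. Qed.

Definition quotient_pt (C : Q) : T := projT1 (cid (svalP C)).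

Lemma quotient_ptP (C : Q) : sval C = [set y | D (quotient_pt C) y = 0].
Proof. exact: projT2 (cid (svalP C)). Qed.

Definition quotient_pi (x : T) : Q := exist _ [set y | D x y = 0] (ex_intro _ x erefl).

Definition quotient_dist (C C' : Q) : K := D (quotient_pt C) (quotient_pt C').

Lemma quotient_dist0 C : quotient_dist C C = 0. Proof. exact: D0. Qed.

Lemma quotient_distC C C' : quotient_dist C C' = quotient_dist C' C.
Proof. exact: DC. Qed.

Lemma quotient_dist_triangle C' C C'' :
  quotient_dist C C'' <= quotient_dist C C' + quotient_dist C' C''.
Proof. exact: DT. Qed.

Lemma pseudodist_eq0_class x y : D x y = 0 -> [set z | D x z = 0] = [set z | D y z = 0].
Proof.
move=> xy; apply/seteqP; split=> z /= h; apply/eqP;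
  rewrite eq_le pseudodist_ge0 andbT.
  by have := DT x y z; rewrite (DC y x); lra.
by have := DT y x z; lra.
Qed.

Lemma quotient_dist_eq0 C C' : quotient_dist C C' = 0 -> C = C'.
Proof.
move=> /pseudodist_eq0_class; rewrite -!quotient_ptP.
case: C C' => [C hC] [C' hC'] /= CC; subst C'.
by congr exist; exact: Prop_irrelevance.
Qed.

Lemma quotient_pi_pt x : D x (quotient_pt (quotient_pi x)) = 0.
Proof.
have /= h := quotient_ptP (quotient_pi x).
have : [set y | D (quotient_pt (quotient_pi x)) y = 0] (quotient_pt (quotient_pi x)).
  exact: D0.
by rewrite -h.
Qed.

Lemma quotient_dist_pi x y : quotient_dist (quotient_pi x) (quotient_pi y) = D x y.
Proof.
have hx := quotient_pi_pt x; have hy := quotient_pi_pt y.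
rewrite /quotient_dist; set x' := quotient_pt _ in hx *; set y' := quotient_pt _ in hy *.
apply/eqP; rewrite eq_le; apply/andP; split.
  have := DT x x' y'; have := DT y x y'; rewrite (DC x' x); lra.
have := DT x' x y; have := DT y' x' y; rewrite (DC y' y); lra.
Qed.

Lemma quotient_pi_surj C : exists x, C = quotient_pi x.
Proof.
exists (quotient_pt C); apply: quotient_dist_eq0.
have -> : quotient_dist C (quotient_pi (quotient_pt C)) =
    D (quotient_pt C) (quotient_pt (quotient_pi (quotient_pt C))) by [].
exact: quotient_pi_pt.
Qed.

HB.instance Definition _ := gen_eqMixin Q.
HB.instance Definition _ := gen_choiceMixin Q.
HB.instance Definition _ := @isMetric.Build K Q quotient_dist
  quotient_dist0 quotient_dist_eq0 quotient_distC quotient_dist_triangle.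

Lemma metric_quotient : exists (Z : metricType K) (pi : T -> Z),
  (forall x y, mdist (pi x) (pi y) = D x y) /\ (forall z, exists x, z = pi x).
Proof.
by exists (Q : metricType K), quotient_pi; split;
  [exact: quotient_dist_pi|exact: quotient_pi_surj].
Qed.

End MetricQuotient.

Section UltraLimit.
Context {K : realType} (U : set_system nat).
Hypothesis U_ultra : UltraFilter U.

Lemma ultra_limit (g : nat -> K) (B : K) : (forall i, `|g i| <= B) ->
  exists l, forall e : K, 0 < e -> U [set i | `|l - g i| < e].
Proof.
move=> gB.
have [|l [_ lP]] := @segment_compact K (- B) B (g @ U) _.
  apply: (@filterS _ U _ setT) => [i _|]; last exact: filterT.
  by rewrite /= in_itv/= -ler_norml.
exists l => e e0.
have [//|Uc] := in_ultra_setVsetC [set i | `|l - g i| < e] U_ultra.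
have [||x [/= x1 x2]] := lP (~` ball l e) (ball l e).
- by rewrite /fmap/=; apply: filterS Uc => i.
- exact: nbhsx_ballx.
- by [].
Qed.

(** An index below [N] that varies with [i] can be made constant on a set of the ultrafilter. *)
Lemma ultra_union (N : nat) (P : nat -> set nat) :
  U [set i | exists2 j, (j < N)%N & P j i] -> exists2 j, (j < N)%N & U (P j).
Proof.
elim: N => [|N ih] h.
  by have [i [j]] := @filter_ex _ U _ _ h.
have [UN|UN] := in_ultra_setVsetC (P N) U_ultra; first by exists N.
have [|j jN Uj] := ih; last by exists j => //; exact: ltnW.
apply: filterS2 UN h => i PN [j]; rewrite ltnS leq_eqVlt => /predU1P[->//|jN Pj].
by exists j.
Qed.

Lemma ultra_forall (N : nat) (P : nat -> set nat) :
  (forall j, (j < N)%N -> U (P j)) -> U [set i | forall j, (j < N)%N -> P j i].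
Proof.
elim: N => [|N ih] h; first by apply: (@filterS _ U _ setT) filterT => i _ j.
have := ih (fun j jN => h j (ltnW jN)); apply: filterS2 (h N (ltnSn N)) => i PN H j.
by rewrite ltnS leq_eqVlt => /predU1P[->//|]; exact: H.
Qed.

End UltraLimit.

(** * Gromov-Hausdorff distance from nets *)

Section GHNets.
Context {K : realType}.

(* A weak form of being a length space, which is preserved by limits. *)
Definition radially_divisible (S : Type) (A : set S) (d : S -> S -> \bar K)
    (a : S) : Prop :=
  forall x (L t : K), A x -> (d a x < L%:E)%E -> 0 <= t <= L ->
  exists m, [/\ A m, (d a m <= t%:E)%E & (d m x <= (L - t)%:E)%E].

(** The part where the extended distance is real valued and calculations can take place in [K]. *)
Definition finite_part (S : Type) (A : set S) (d : S -> S -> \bar K) (a : S) :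
    set S := [set x | A x /\ (d a x < +oo)%E].

Lemma finite_partE (S : Type) (A : set S) (d : S -> S -> \bar K) (a x y : S) :
  is_epseudometric A d -> A a -> finite_part A d a x -> finite_part A d a y ->
  d x y = (fine (d x y))%:E.
Proof.
move=> [_ d0 dC dT] Aa [Ax ax] [Ay ay]; rewrite fineK// ge0_fin_numE ?d0//.
by apply: (le_lt_trans (dT x a y Ax Aa Ay)); rewrite lte_add_pinfty// dC.
Qed.

(** Moving [x] inwards to radius [s - 2 * eta] leaves [eta] for reaching the net and [eta] for the
    distortion, so the partner [w j] stays in the ball of radius [s]. If [s] is at most [2 * eta],
    the base point serves. *)
Lemma net_shrink (S T : Type) (A : set S) (dA : S -> S -> \bar K) (a : S)
    (B : set T) (dB : T -> T -> \bar K) (b : T)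
    (N : nat) (c : nat -> S) (w : nat -> T) (eta s s' : K) (x : S) :
  is_epseudometric A dA -> is_epseudometric B dB -> A a -> B b ->
  radially_divisible A dA a -> 0 < eta -> 0 < s -> s <= s' -> (0 < N)%N ->
  (forall j, finite_part A dA a (c j)) -> (forall j, finite_part B dB b (w j)) ->
  c 0%N = a -> w 0%N = b ->
  (forall j k, (j < N)%N -> (k < N)%N ->
     `|fine (dA (c j) (c k)) - fine (dB (w j) (w k))| <= eta) ->
  (forall y, A y -> (dA a y <= s'%:E)%E -> exists2 j, (j < N)%N &
     (dA (c j) y <= eta%:E)%E) ->
  A x -> (dA a x <= s%:E)%E ->
  exists2 j, (j < N)%N & (dB b (w j) <= s%:E)%E /\ (dA x (c j) <= (4 * eta)%:E)%E.
Proof.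
move=> Aepm Bepm Aa Ba rA eta0 s0 ss' N0 cA wB c0 w0 cw net Ax ax.
have [d0 dge0 dC dT] := Aepm; have [e0 _ _ _] := Bepm.
have [s2|s2] := leP s (2 * eta).
  exists 0%N => //; rewrite w0 c0 e0// lee_fin ltW//; split => //.
  by rewrite dC//; apply: (le_trans ax); rewrite lee_fin; lra.
(* The bound [s + eta] gives the strict inequality that divisibility requires. Then [m] is within
   [3 * eta] of [x], and its net point within [4 * eta]. *)
have [||m [Am am mx]] := rA x (s + eta) (s - 2 * eta) Ax.
- by apply: (le_lt_trans ax); rewrite lte_fin; lra.
- by lra.
have [|j jN cm] := net m Am; first by apply: (le_trans am); rewrite lee_fin; lra.
exists j => //.
have Ac : A (c j) by case: (cA j).
have acj : (dA a (c j) <= (s - eta)%:E)%E.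
  apply: (le_trans (dT a m (c j) Aa Am Ac)); rewrite (dC m)//.
  by apply: (le_trans (leeD am cm)); rewrite -EFinD lee_fin; lra.
split; last first.
  apply: (le_trans (dT x m (c j) Ax Am Ac)); rewrite (dC x m)// (dC m (c j))//.
  by apply: (le_trans (leeD mx cm)); rewrite -EFinD lee_fin; lra.
have := cw 0%N j N0 jN; rewrite c0 w0.
have Ea : finite_part A dA a a by split; rewrite ?d0.
have Eb : finite_part B dB b b by split; rewrite ?e0.
move: acj; rewrite (finite_partE Aepm Aa Ea (cA j)).
rewrite [dB _ _](finite_partE Bepm Ba Eb (wB j)) !lee_fin /=.
by rewrite ler_norml => h /andP[h1 h2]; lra.
Qed.

Lemma pointed_gh_dist_net (S T : Type) (A : set S) (dA : S -> S -> \bar K)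
    (a : S) (B : set T) (dB : T -> T -> \bar K) (b : T)
    (N : nat) (c : nat -> S) (w : nat -> T) (eta s s' : K) :
  is_epseudometric A dA -> is_epseudometric B dB -> A a -> B b ->
  radially_divisible A dA a -> radially_divisible B dB b ->
  0 < eta -> 0 < s -> s <= s' -> (0 < N)%N ->
  (forall j, finite_part A dA a (c j)) -> (forall j, finite_part B dB b (w j)) ->
  c 0%N = a -> w 0%N = b ->
  (forall j k, (j < N)%N -> (k < N)%N ->
     `|fine (dA (c j) (c k)) - fine (dB (w j) (w k))| <= eta) ->
  (forall y, A y -> (dA a y <= s'%:E)%E -> exists2 j, (j < N)%N &
     (dA (c j) y <= eta%:E)%E) ->
  (forall y, B y -> (dB b y <= s'%:E)%E -> exists2 j, (j < N)%N &
     (dB (w j) y <= eta%:E)%E) ->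
  (pointed_gh_dist (A `&` cball dA a s) dA a (B `&` cball dB b s) dB b
   <= (6 * eta)%:E)%E.
Proof.
move=> Aepm Bepm Aa Ba rA rB eta0 s0 ss' N0 cA wB c0 w0 cw netA netB.
have [dA0 dAge0 dAC dAT] := Aepm; have [dB0 dBge0 dBC dBT] := Bepm.
pose DA x y := fine (dA x y); pose DB x y := fine (dB x y).
pose A0 := finite_part A dA a; pose B0 := finite_part B dB b.
have A0A x : A0 x -> A x by case.
have B0B x : B0 x -> B x by case.
have EA x y : A0 x -> A0 y -> dA x y = (DA x y)%:E.
  by move=> hx hy; exact: finite_partE hx hy.
have EB x y : B0 x -> B0 y -> dB x y = (DB x y)%:E.
  by move=> hx hy; exact: finite_partE hx hy.
have DAge0 x y : A0 x -> A0 y -> 0 <= DA x y.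
  by move=> hx hy; rewrite -lee_fin -EA//; apply: dAge0; exact: A0A.
have DBge0 x y : B0 x -> B0 y -> 0 <= DB x y.
  by move=> hx hy; rewrite -lee_fin -EB//; apply: dBge0; exact: B0B.
have DAC x y : A0 x -> A0 y -> DA x y = DA y x.
  by move=> hx hy; rewrite /DA dAC//; exact: A0A.
have DBC x y : B0 x -> B0 y -> DB x y = DB y x.
  by move=> hx hy; rewrite /DB dBC//; exact: B0B.
have DAT y x z : A0 x -> A0 y -> A0 z -> DA x z <= DA x y + DA y z.
  move=> hx hy hz; rewrite -lee_fin EFinD -!EA//; apply: dAT; exact: A0A.
have DBT y x z : B0 x -> B0 y -> B0 z -> DB x z <= DB x y + DB y z.
  move=> hx hy hz; rewrite -lee_fin EFinD -!EB//; apply: dBT; exact: B0B.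
have DA0 x : A0 x -> DA x x = 0 by move=> hx; rewrite /DA dA0//; exact: A0A.
have DB0 x : B0 x -> DB x x = 0 by move=> hx; rewrite /DB dB0//; exact: B0B.
(* The two spaces are glued along the nets, with bridges of length [eta] between partners. A path
   that crosses over and back pays [2 * eta], which covers the distortion [eta]; hence the triangle
   inequality. *)
pose F x y := [set DA x (c j) + eta + DB (w j) y | j in [set j | (j < N)%N]].
pose r0 x y := inf (F x y).
have r0_le x y j : A0 x -> B0 y -> (j < N)%N ->
    r0 x y <= DA x (c j) + eta + DB (w j) y.
  move=> hx hy jN; apply: ge_inf; last by exists j.
  exists 0 => _ [k _ <-]; have := DAge0 _ _ hx (cA k).
  by have := DBge0 _ _ (wB k) hy; lra.
have r0_ge x y v : (forall j, (j < N)%N -> v <= DA x (c j) + eta + DB (w j) y) ->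
    v <= r0 x y.
  move=> h; apply: lb_le_inf; first by exists (DA x (c 0%N) + eta + DB (w 0%N) y), 0%N.
  by move=> _ [j jN <-]; exact: h.
(* Made from real distances, [rho] is right only on the finite parts, which contain both balls. *)
pose rho (u v : S + T) : \bar K := match u, v with
  | inl x, inl x' => (DA x x')%:E | inr y, inr y' => (DB y y')%:E
  | inl x, inr y => (r0 x y)%:E | inr y, inl x => (r0 x y)%:E end.
have AA0 x : (A `&` cball dA a s) x -> A0 x.
  by move=> [Ax ax]; split => //; apply: (le_lt_trans ax); rewrite ltry.
have BB0 y : (B `&` cball dB b s) y -> B0 y.
  by move=> [By By']; split => //; apply: (le_lt_trans By'); rewrite ltry.
have A0a : A0 a by rewrite -c0; exact: cA.
have B0b : B0 b by rewrite -w0; exact: wB.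
have adm : gh_admissible (A `&` cball dA a s) dA (B `&` cball dB b s) dB rho.
  split; last 2 first.
  - by move=> x x' hx hx'; rewrite [RHS]EA//; exact: AA0.
  - by move=> x x' hx hx'; rewrite [RHS]EB//; exact: BB0.
  have cd j k : (j < N)%N -> (k < N)%N -> DA (c j) (c k) <= DB (w j) (w k) + eta /\
      DB (w j) (w k) <= DA (c j) (c k) + eta.
    by move=> jN kN; have := cw j k jN kN; rewrite ler_norml -/DA -/DB => /andP[]; split; rewrite /DA /DB; lra.
  split.
  - by move=> u [[x /AA0 hx <-]|[y /BB0 hy <-]]; rewrite /rho/= ?DA0 ?DB0.
  - move=> u v [[x /AA0 hx <-]|[x /BB0 hx <-]] [[y /AA0 hy <-]|[y /BB0 hy <-]];
      rewrite /rho lee_fin; [exact: DAge0| | |exact: DBge0]; apply: (r0_ge) => j jN.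
      by have := DAge0 _ _ hx (cA j); have := DBge0 _ _ (wB j) hy; lra.
    by have := DAge0 _ _ hy (cA j); have := DBge0 _ _ (wB j) hx; lra.
  - move=> u v [[x /AA0 hx <-]|[x /BB0 hx <-]] [[y /AA0 hy <-]|[y /BB0 hy <-]] //=.
      by rewrite DAC.
    by rewrite DBC.
  - move=> u v t [[x /AA0 hx <-]|[x /BB0 hx <-]] [[y /AA0 hy <-]|[y /BB0 hy <-]]
      [[z /AA0 hz <-]|[z /BB0 hz <-]]; rewrite /rho -EFinD lee_fin.
    + exact: DAT.
    + rewrite -lerBlDl; apply: (r0_ge) => j jN; rewrite lerBlDl.
      apply: (le_trans (r0_le _ _ _ hx hz jN)).
      by have := DAT y x (c j) hx hy (cA j); lra.
    + rewrite -lerBlDl; apply: (r0_ge) => j jN.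
      rewrite lerBlDl -lerBlDr; apply: (r0_ge) => k kN.
      have [h _] := cd k j kN jN.
      have := DAT (c k) x z hx (cA k) hz; have := DAT (c j) (c k) z (cA k) (cA j) hz.
      have := DBT y (w k) (w j) (wB k) hy (wB j).
      rewrite (DBC _ _ hy (wB j)) (DAC _ _ hz (cA j)); lra.
    + rewrite -lerBlDr; apply: (r0_ge) => j jN; rewrite lerBlDr.
      apply: (le_trans (r0_le _ _ _ hx hz jN)).
      by have := DBT y (w j) z (wB j) hy hz; lra.
    + rewrite -lerBlDr; apply: (r0_ge) => j jN; rewrite lerBlDr.
      apply: (le_trans (r0_le _ _ _ hz hx jN)).
      by have := DAT y z (c j) hz hy (cA j); rewrite (DAC _ _ hz hy); lra.
    + rewrite -lerBlDl; apply: (r0_ge) => j jN.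
      rewrite lerBlDl -lerBlDr; apply: (r0_ge) => k kN.
      have [_ h] := cd k j kN jN.
      have := DBT (w k) x z hx (wB k) hz; have := DBT (w j) (w k) z (wB k) (wB j) hz.
      have := DAT y (c k) (c j) (cA k) hy (cA j).
      rewrite (DAC _ _ hy (cA k)) (DBC _ _ hx (wB k)); lra.
    + rewrite -lerBlDl; apply: (r0_ge) => j jN; rewrite lerBlDl.
      apply: (le_trans (r0_le _ _ _ hz hx jN)).
      by have := DBT y (w j) x (wB j) hy hx; rewrite (DBC _ _ hy hx); lra.
    + exact: DBT.
apply: (@le_trans _ _ (maxe (hausdorff_dist rho (inl @` (A `&` cball dA a s))
    (inr @` (B `&` cball dB b s))) (rho (inl a) (inr b)))).
  by apply: ereal_inf_lbound; exists rho.
rewrite ge_max; apply/andP; split; last first.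
  rewrite /= lee_fin; apply: (le_trans (r0_le _ _ 0%N A0a B0b N0)).
  by rewrite c0 w0 (DA0 _ A0a) (DB0 _ B0b); lra.
have cw' j k : (j < N)%N -> (k < N)%N ->
     `|fine (dB (w j) (w k)) - fine (dA (c j) (c k))| <= eta.
  by move=> jN kN; rewrite distrC cw.
(* A point is within [4 * eta] of its net point, and the bridge adds [eta]. *)
apply: ereal_inf_lbound; exists (6 * eta) => //; split; first by lra.
- move=> _ [x hx <-]; have [Ax ax] := hx.
  have [j jN [bw xc]] := net_shrink Aepm Bepm Aa Ba rA eta0 s0 ss' N0 cA wB c0 w0
    cw netA Ax ax.
  have [Bw _] := wB j.
  exists (inr (w j)); first by exists (w j).
  rewrite /= lee_fin; apply: (le_trans (r0_le _ _ _ (AA0 _ hx) (wB j) jN)).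
  by move: xc; rewrite (EA _ _ (AA0 _ hx) (cA j)) lee_fin (DB0 _ (wB j)); lra.
- move=> _ [x hx <-]; have [Bx bx] := hx.
  have [j jN [bw xc]] := net_shrink Bepm Aepm Ba Aa rB eta0 s0 ss' N0 wB cA w0 c0
    cw' netB Bx bx.
  have [Ac _] := cA j.
  exists (inl (c j)); first by exists (c j).
  rewrite /= lee_fin; apply: (le_trans (r0_le _ _ _ (cA j) (BB0 _ hx) jN)).
  move: xc; rewrite (EB _ _ (BB0 _ hx) (wB j)) lee_fin.
  by rewrite (DA0 _ (cA j)) (DBC _ _ (BB0 _ hx) (wB j)); lra.
Qed.

End GHNets.

(** * Gromov's precompactness theorem *)

Section GromovPrecompactness.
Context {K : realType} (X : nat -> Type) (A : forall i, set (X i))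
  (d : forall i, X i -> X i -> \bar K) (a : forall i, X i).
Arguments A : clear implicits.
Hypothesis d_epm : forall i, is_epseudometric (A i) (@d i).
Hypothesis Aa : forall i, A i (a i).
Hypothesis rdiv : forall i, radially_divisible (A i) (@d i) (a i).

Definition bounded_seq : Type := {x : forall i, X i |
  (forall i, A i (x i)) /\ exists C : K, forall i, (d (a i) (x i) <= C%:E)%E}.

Definition seq_dist (x y : bounded_seq) (i : nat) : K :=
  fine (d (sval x i) (sval y i)).

Lemma bounded_seq_in (x : bounded_seq) i : finite_part (A i) (@d i) (a i) (sval x i).
Proof.
have [xA [C xC]] := svalP x; split; first exact: xA.
by apply: (le_lt_trans (xC i)); rewrite ltry.
Qed.

Lemma bounded_seqA (x : bounded_seq) i : A i (sval x i).
Proof. by case: (bounded_seq_in x i). Qed.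

Lemma seq_distE x y i : d (sval x i) (sval y i) = (seq_dist x y i)%:E.
Proof. by apply: finite_partE (d_epm i) (Aa i) _ _; exact: bounded_seq_in. Qed.

Lemma seq_dist_ge0 x y i : 0 <= seq_dist x y i.
Proof.
have [_ + _ _] := d_epm i; move=> h; apply/fine_ge0/h; exact: bounded_seqA.
Qed.

Lemma seq_distxx x i : seq_dist x x i = 0.
Proof.
by have [h _ _ _] := d_epm i; rewrite /seq_dist h//; exact: bounded_seqA.
Qed.

Lemma seq_distC x y i : seq_dist x y i = seq_dist y x i.
Proof.
by have [_ _ h _] := d_epm i; rewrite /seq_dist h//; exact: bounded_seqA.
Qed.

Lemma seq_dist_triangle y x z i :
  seq_dist x z i <= seq_dist x y i + seq_dist y z i.
Proof.
rewrite -lee_fin EFinD -!seq_distE; have [_ _ _ h] := d_epm i; apply: h; exact: bounded_seqA.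
Qed.

Lemma base_seqP : (forall i, A i (a i)) /\
  exists C : K, forall i, (d (a i) (a i) <= C%:E)%E.
Proof.
by split=> //; exists 0 => i; have [-> // _ _ _] := d_epm i.
Qed.

Definition base_seq : bounded_seq := exist _ a base_seqP.

Lemma seq_dist_bounded x y : exists C : K, forall i, `|seq_dist x y i| <= C.
Proof.
have [_ [Cx xC]] := svalP x; have [_ [Cy yC]] := svalP y.
exists (Cx + Cy) => i; rewrite ger0_norm ?seq_dist_ge0//.
apply: (le_trans (seq_dist_triangle base_seq x y i)).
rewrite seq_distC; apply: lerD; rewrite -lee_fin -seq_distE; [exact: xC|exact: yC].
Qed.

Definition has_nets : Prop := forall s e : K, 0 < e -> exists N,
  \forall i \near \oo, exists c : nat -> X i, (forall j, A i (c j)) /\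
    forall y, A i y -> (d (a i) y <= s%:E)%E ->
      exists2 j, (j < N)%N & (d (c j) y <= e%:E)%E.

Definition has_local_nets (eta : K) : Prop := forall e : K, 0 < e -> exists N,
  \forall i \near \oo, forall x, A i x -> exists c : nat -> X i,
    (forall j, A i (c j)) /\ forall y, A i y -> (d x y <= eta%:E)%E ->
      exists2 j, (j < N)%N & (d (c j) y <= e%:E)%E.

(* Points at distance at most [(k + 1) * eta / 4] are within [eta] of the net
   for radius [k * eta / 4]. *)
Lemma has_local_nets_has_nets (eta : K) : 0 < eta -> has_local_nets eta -> has_nets.
Proof.
move=> eta0 loc s.
suff key (k : nat) (e : K) : 0 < e -> exists N, \forall i \near \oo,
    exists c : nat -> X i, (forall j, A i (c j)) /\
      forall y, A i y -> (d (a i) y <= (k%:R * (eta / 4))%:E)%E ->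
        exists2 j, (j < N)%N & (d (c j) y <= e%:E)%E.
  move=> e e0; have eta4 : 0 < eta / 4 by rewrite divr_gt0.
  have [m sm] := filter_ex (nbhs_infty_ger (s / (eta / 4))).
  have [N NP] := key m e e0.
  exists N; apply: filterS NP => i [c [cA cP]]; exists c; split => // y Ay ay.
  apply: cP => //; apply: (le_trans ay); by rewrite lee_fin -ler_pdivrMr.
elim: k e => [|k ih] e e0.
  exists 1%N; near=> i; exists (fun=> a i); split => // y Ay ay; exists 0%N => //.
  by apply: (le_trans ay); rewrite lee_fin mul0r ltW.
have eta2 : 0 < eta / 2 by rewrite divr_gt0.
have [N1 P1] := ih (eta / 2) eta2; have [N2 P2] := loc e e0.
exists (N1 * N2)%N; apply: filterS2 P1 P2 => i [c [cA cP]] H.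
have [_ _ dC dT] := d_epm i.
have [c' c'P] := choice (fun j => H (c j) (cA j)).
(* Pairs of a center of the first net and one of its local net, encoded as [j * N2 + l]. *)
exists (fun l => c' (l %/ N2)%N (l %% N2)%N); split.
  by move=> l; case: (c'P (l %/ N2)%N) => h _; exact: h.
move=> y Ay ay.
(* The factor [k.+2] makes the bound strict. So [m] is within [eta / 2] of [y], and the coarse net
   adds another [eta / 2]. *)
have [||m [Am am my]] := @rdiv i y (k.+2%:R * (eta / 4)) (k%:R * (eta / 4)) Ay.
- by apply: (le_lt_trans ay); rewrite lte_fin ltr_pM2r ?divr_gt0// ltr_nat.
- apply/andP; split; first by rewrite mulr_ge0// divr_ge0// ltW.
  by apply: ler_wpM2r; [rewrite divr_ge0// ltW|rewrite ler_nat -addn2 leq_addr].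
have [j jN cm] := cP m Am am.
have cy : (d (c j) y <= eta%:E)%E.
  apply: (le_trans (dT _ _ _ (cA j) Am Ay)); apply: (le_trans (leeD cm my)).
  by rewrite -EFinD lee_fin -[k.+2%:R]natr1 -[k.+1%:R]natr1; lra.
have [_ /(_ y Ay cy)[l lN ly]] := c'P j.
have N20 : (0 < N2)%N by exact: leq_ltn_trans lN.
exists (j * N2 + l)%N.
  by rewrite (leq_trans (n := (j.+1 * N2)%N))// ?leq_mul2r ?jN ?orbT// mulSn addnC ltn_add2r.
by rewrite divnMDl// divn_small// addn0 modnMDl modn_small.
Unshelve. all: by end_near. Qed.

(** Finite nets of equal size with almost equal distances, at precision [k.+1%:R^-1] on balls of
    radius [k.+1%:R]: the input of [pointed_gh_dist_net]. *)
Definition common_net (Z : metricType K) (z : Z) (i k : nat) : Prop :=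
  exists N (c : nat -> X i) (w : nat -> Z),
  [/\ (0 < N)%N, forall j, finite_part (A i) (@d i) (a i) (c j),
      c 0%N = a i /\ w 0%N = z,
      forall j l, (j < N)%N -> (l < N)%N ->
        `|fine (d (c j) (c l)) - mdist (w j) (w l)| <= k.+1%:R^-1 &
      (forall y, A i y -> (d (a i) y <= k.+1%:R%:E)%E -> exists2 j, (j < N)%N &
        (d (c j) y <= k.+1%:R^-1%:E)%E) /\
      (forall y, mdist z y <= k.+1%:R -> exists2 j, (j < N)%N &
        mdist (w j) y <= k.+1%:R^-1)].

Lemma ultralimit_space : has_nets -> exists (Z : metricType K) (z : Z),
  radially_divisible setT (@emdist K Z) z /\
  forall k n, exists2 i, (n < i)%N & common_net z i k.
Proof.
move=> nets.
have [U [U_ultra UF]] := ultraFilterLemma (eventually_filter : ProperFilter \oo).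
have : forall xy : bounded_seq * bounded_seq, exists l : K,
    forall e : K, 0 < e -> U [set i | `|l - seq_dist xy.1 xy.2 i| < e].
  by move=> [x y]; have [C xyC] := seq_dist_bounded x y; exact: ultra_limit xyC.
move=> /choice[D' DP']; pose D x y := D' (x, y).
have DP x y e : 0 < e -> U [set i | `|D x y - seq_dist x y i| < e].
  by move=> e0; exact: (DP' (x, y) e e0).
have D_le x y B : U [set i | seq_dist x y i <= B] -> D x y <= B.
  move=> h; apply/ler_addgt0Pr => e e0.
  have [i [/= h1]] := @filter_ex _ U _ _ (filterI h (DP x y e e0)).
  by rewrite ltr_norml => /andP[]; lra.
have D_lt x y B : D x y < B -> U [set i | seq_dist x y i < B].
  move=> h; have e0 : 0 < B - D x y by lra.
  apply: filterS (DP x y _ e0) => i /=.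
  by rewrite ltr_norml => /andP[]; lra.
have D_ge0 x y : 0 <= D x y.
  apply/ler_addgt0Pr => e e0.
  have [i /=] := @filter_ex _ U _ _ (DP x y e e0).
  by have := seq_dist_ge0 x y i; rewrite ltr_norml => ? /andP[]; lra.
have D_pseudodist : is_pseudodist D.
  split=> [x|x y|y x z].
  - apply/eqP; rewrite eq_le D_ge0 andbT; apply: D_le.
    by apply: (@filterS _ U _ setT) filterT => i _ /=; rewrite seq_distxx.
  - by apply/eqP; rewrite eq_le; apply/andP; split; apply/ler_addgt0Pr => e e0;
      apply: D_le; [have /D_lt : D y x < D y x + e by lra
                   |have /D_lt : D x y < D x y + e by lra];
      apply: filterS => i /=; rewrite seq_distC; exact: ltW.
  - apply/ler_addgt0Pr => e e0; apply: D_le.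
    have /D_lt h1 : D x y < D x y + e / 2 by lra.
    have /D_lt h2 : D y z < D y z + e / 2 by lra.
    apply: filterS2 h1 h2 => i /= h1 h2.
    by have := seq_dist_triangle y x z i; lra.
have [Z [pi [piD piS]]] := metric_quotient D_pseudodist.
exists Z, (pi base_seq); split.
  move=> v L t _; have [x ->] := piS v.
  rewrite /emdist piD lte_fin => /D_lt xL t0L.
  have /andP[t0 tL] := t0L.
  (* Where [x] is too far away the base point is taken, so that the intermediate points form a
     bounded sequence, that is, a point of the limit. *)
  have : forall i, exists m, [/\ A i m, (d (a i) m <= t%:E)%E &
      seq_dist base_seq x i < L -> (d m (sval x i) <= (L - t)%:E)%E].
    move=> i; have [xiL|_] := ltP (seq_dist base_seq x i) L; last first.
      by exists (a i); split => //; have [-> // _ _ _] := d_epm i; rewrite lee_fin.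
    have [|] := @rdiv i (sval x i) L t (bounded_seqA x i) _ t0L.
      by move: xiL; rewrite -lte_fin -seq_distE.
    by move=> m [m1 m2 m3]; exists m.
  move=> mP; pose m i := projT1 (cid (mP i)).
  have mA i : A i (m i) by case: (projT2 (cid (mP i))).
  have mt i : (d (a i) (m i) <= t%:E)%E by case: (projT2 (cid (mP i))).
  have mx i : seq_dist base_seq x i < L -> (d (m i) (sval x i) <= (L - t)%:E)%E.
    by case: (projT2 (cid (mP i))).
  pose m' : bounded_seq := exist _ m (conj mA (ex_intro _ t mt)).
  exists (pi m'); rewrite !piD !lee_fin; split => //; apply: D_le.
    apply: (@filterS _ U _ setT) filterT => i _ /=.
    by rewrite -lee_fin -seq_distE; exact: mt.
  by apply: filterS xL => i /mx; rewrite /= -lee_fin -seq_distE.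
move=> k n.
have e0 : 0 < k.+1%:R^-1 :> K by rewrite invr_gt0 ltr0n.
have e1 : k.+1%:R^-1 <= 1 :> K by rewrite invf_le1 ?ler1n// ltr0n.
set e : K := k.+1%:R^-1 in e0 e1.
(* A limit point within [k.+1%:R] of the base is represented by points within [k.+2%:R] only. The
   centers that serve them lie within [k.+3%:R], as [e] is at most 1. *)
have [N NP] := nets k.+2%:R e e0.
have : forall i, exists c : nat -> X i, [/\ forall j, A i (c j),
    forall j, (d (a i) (c j) <= k.+3%:R%:E)%E, c 0%N = a i &
    (exists c : nat -> X i, (forall j, A i (c j)) /\
      forall y, A i y -> (d (a i) y <= k.+2%:R%:E)%E ->
        exists2 j, (j < N)%N & (d (c j) y <= e%:E)%E) ->
    forall y, A i y -> (d (a i) y <= k.+2%:R%:E)%E ->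
      exists2 j, (j < N.+1)%N & (d (c j) y <= e%:E)%E].
  move=> i; have [d0 _ dC dT] := d_epm i.
  have aa : (d (a i) (a i) <= k.+3%:R%:E)%E by rewrite d0// lee_fin.
  have [[c [cA cP]]|no] := pselect (exists c : nat -> X i, (forall j, A i (c j)) /\
      forall y, A i y -> (d (a i) y <= k.+2%:R%:E)%E ->
        exists2 j, (j < N)%N & (d (c j) y <= e%:E)%E); last first.
    by exists (fun=> a i); split.
  (* The base point is put in front, whence [N.+1], and centers too far out to be of use are
     replaced by it; this keeps the sequences of centers bounded. *)
  exists (fun j => if j is j'.+1 then
    if (d (a i) (c j') <= k.+3%:R%:E)%E then c j' else a i else a i); split => //.
  - by move=> [|j] //; case: ifP.
  - by move=> [|j] //; case: ifP.
  - move=> _ y Ay ay; have [j jN cy] := cP y Ay ay; exists j.+1 => //=.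
    rewrite ifT//; apply: (le_trans (dT _ _ _ (Aa i) Ay (cA j))).
    rewrite (dC y)//; apply: (le_trans (leeD ay cy)).
    by rewrite -EFinD lee_fin -[k.+3%:R]natr1 lerD2l.
move=> cP; pose c i := projT1 (cid (cP i)).
have cA i j : A i (c i j) by case: (projT2 (cid (cP i))) => h _ _ _; exact: h.
have cb j i : (d (a i) (c i j) <= k.+3%:R%:E)%E.
  by case: (projT2 (cid (cP i))) => _ h _ _; exact: h.
have c0 i : c i 0%N = a i by case: (projT2 (cid (cP i))).
have cnet : U [set i | forall y, A i y -> (d (a i) y <= k.+2%:R%:E)%E ->
      exists2 j, (j < N.+1)%N & (d (c i j) y <= e%:E)%E].
  by apply: UF; apply: filterS NP => i h; case: (projT2 (cid (cP i))) => _ _ _; exact.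
pose x j : bounded_seq := exist _ (fun i => c i j)
  (conj (fun i => cA i j) (ex_intro _ k.+3%:R (cb j))).
have x0 : pi (x 0%N) = pi base_seq.
  apply: mdist_positivity; rewrite piD; apply/eqP; rewrite eq_le D_ge0 andbT.
  apply: D_le; apply: (@filterS _ U _ setT) filterT => i _ /=.
  by rewrite /seq_dist/= c0; have [-> // _ _ _] := d_epm i.
have Zne y : mdist (pi base_seq) y <= k.+1%:R -> exists2 j, (j < N.+1)%N &
    mdist (pi (x j)) y <= e.
  have [u ->] := piS y; rewrite piD => Du.
  have /D_lt uk : D base_seq u < k.+2%:R.
    by apply: (le_lt_trans Du); rewrite ltr_nat.
  have [|j jN Uj] := @ultra_union U U_ultra N.+1
      (fun j => [set i | seq_dist (x j) u i <= e]).
    apply: filterS2 cnet uk => i h1 h2.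
    have [||j jN xj] := h1 (sval u i).
    - exact: bounded_seqA.
    - by rewrite (seq_distE base_seq) lee_fin ltW.
    by exists j => //=; rewrite -lee_fin -seq_distE.
  by exists j => //; rewrite piD; exact: D_le.
have Udist : U [set i | forall j, (j < N.+1)%N -> forall l, (l < N.+1)%N ->
    `|D (x j) (x l) - seq_dist (x j) (x l) i| < e].
  apply: (@ultra_forall U U_ultra N.+1 (fun j => [set i | forall l, (l < N.+1)%N ->
    `|D (x j) (x l) - seq_dist (x j) (x l) i| < e])) => j jN.
  apply: (@ultra_forall U U_ultra N.+1 (fun l => [set i |
    `|D (x j) (x l) - seq_dist (x j) (x l) i| < e])) => l lN.
  exact: DP.
have Un : U [set i | (n < i)%N] by apply: UF; exists n.+1.
have [i [[/= i1 i2] i3]] := @filter_ex _ U _ _ (filterI (filterI cnet Udist) Un).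
exists i => //; exists N.+1, (c i), (fun j => pi (x j)); split => //.
- by move=> j; exact: (bounded_seq_in (x j)).
- move=> j l jN lN; rewrite piD distrC; apply: ltW; exact: i2.
- split => // y Ay ay; apply: i1 => //; apply: (le_trans ay).
  by rewrite lee_fin ler_nat.
Qed.

Lemma pointed_gh_dist_ge0 (S T : Type) (B : set S) (dB : S -> S -> \bar K) b
    (C : set T) (dC : T -> T -> \bar K) c :
  (0 <= pointed_gh_dist B dB b C dC c)%E.
Proof.
apply: le_ereal_inf_tmp => _ [rho _ <-]; rewrite le_max; apply/orP; left.
by apply: le_ereal_inf_tmp => _ [e [e0 _ _] <-]; rewrite lee_fin ltW.
Qed.

Theorem gromov_precompactness : has_nets ->
  exists2 phi : nat -> nat, {homo phi : i j / (i < j)%N} &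
  exists (Z : metricType K) (z : Z),
    pointed_gh_cvg (fun i => A (phi i)) (fun i => @d (phi i))
      (fun i => a (phi i)) [set: Z] (@emdist K Z) z.
Proof.
move=> /ultralimit_space[Z [z [Zdiv net]]].
have : forall kn : nat * nat, exists i, (kn.2 < i)%N /\ common_net z i kn.1.
  by move=> [k n]; have [i i1 i2] := net k n; exists i.
move=> /choice[pick pickP].
(* A diagonal choice: each index lies beyond the previous one and has a common net of the next
   precision with the limit. *)
pose phi := fix phi k := if k is k'.+1 then pick (k, phi k') else pick (0, 0)%N.
exists phi.
  apply: homo_ltn; first exact: ltn_trans.
  by move=> k /=; have [] := pickP (k.+1, phi k).
have phiP k : common_net z (phi k) k.
  by case: k => [|k] /=; [have [] := pickP (0, 0)%N|have [] := pickP (k.+1, phi k)].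
exists Z, z => s s0.
apply: (@squeeze_cvge _ _ _ _ (cst 0%E) _ (fun k => (6 * k.+1%:R^-1)%:E)).
- near=> k; apply/andP; split; first exact: pointed_gh_dist_ge0.
  have [N [c [w [N0 cA [c0 w0] cw [netA netZ]]]]] := phiP k.
  apply: (pointed_gh_dist_net (N := N) (c := c) (w := w) (s' := k.+1%:R)) => //.
  + exact: (@emdist_epm K Z).
  + by near: k; apply: filterS (nbhs_infty_ger s) => k; rewrite -natr1; lra.
  + by move=> j; split => //; rewrite ltry.
  + move=> v _ zv; have [|j jN wv] := netZ v; first by rewrite -lee_fin.
    exists j => //.
- exact: cvg_cst.
- apply: cvg_EFin; first by near=> k.
  have := @cvgM K nat \oo _ (cst 6) harmonic 6 0 (cvg_cst _) cvg_harmonic.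
  by rewrite mulr0; apply.
Unshelve. all: by end_near. Qed.

End GromovPrecompactness.

(** * Lengths of curves in coordinates *)

Section Curves.
Context {K : realType} {n : nat}.
Implicit Types (D : set 'rV[K]_n) (G : 'rV[K]_n -> 'M[K]_n) (u : K -> 'rV[K]_n).

Definition speed G u (t : K) : K := Num.sqrt (qform (G (u t)) (derive1 u t)).

Lemma is_derive_affine (c k t : K) :
  is_derive t (1 : K) (fun s => c + k * s) k.
Proof.
have h := is_deriveD (is_derive_cst c t 1) (is_deriveZ k (is_derive_id t 1)).
by apply: (is_derive_eq h); rewrite add0r /GRing.scale/= mulr1.
Qed.

Lemma derive1_affine u (c k t : K) : derivable u (c + k * t) 1 ->
  derivable (fun s => u (c + k * s)) t 1 /\
  derive1 (fun s => u (c + k * s)) t = k *: derive1 u (c + k * t).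
Proof.
move=> /derivable1_diffP du.
have [da Da] := is_derive_affine c k t.
have da' := (derivable1_diffP _ _).1 da.
have d : differentiable (u \o (fun s => c + k * s)) t.
  exact: differentiable_comp.
split; first exact/derivable1_diffP.
rewrite derive1E'// diff_comp//= -derive1E'// derive1E Da.
by rewrite derive1E'// -linearZ/= /GRing.scale/= mulr1.
Qed.

Lemma is_C1_affine u (c k : K) : is_C1_curve u ->
  is_C1_curve (fun s => u (c + k * s)).
Proof.
move=> [du cu]; split=> [t|]; first by have [] := derive1_affine (du (c + k * t)).
have -> : derive1 (fun s => u (c + k * s)) = (fun t => k *: derive1 u (c + k * t)).
  by apply/funext => t; have [] := derive1_affine (du (c + k * t)).
move=> t; apply: cvgZl_tmp.
apply: (@continuous_comp _ _ _ (fun s => c + k * s) (derive1 u)); last exact: cu.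
by apply: cvgD; [exact: cvg_cst|apply: cvgM; [exact: cvg_cst|exact: cvg_id]].
Qed.

Lemma C1_continuous u : is_C1_curve u -> continuous u.
Proof. by move=> [du _] t; apply/differentiable_continuous/derivable1_diffP. Qed.

Lemma speed_continuous D G u :
  (forall a b x, D x -> {for x, continuous (fun y => G y a b)}) ->
  is_C1_curve u -> (forall t, 0 <= t <= 1 -> D (u t)) ->
  forall t, 0 <= t <= 1 -> {for t, continuous (speed G u)}.
Proof.
move=> cG uC uD t t01; have [_ cu'] := uC.
apply: (@continuous_comp _ _ _ (fun s => qform (G (u s)) (derive1 u s)) Num.sqrt);
  last exact: sqrt_continuous.
have cc j : {for t, continuous (fun s => derive1 u s 0 j)}.
  apply: (@continuous_comp _ _ _ (derive1 u) (fun M : 'rV[K]_n => M 0 j)); first exact: cu'.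
  exact: coord_continuous.
have csum (F : 'I_n -> K -> K) : (forall i, {for t, continuous (F i)}) ->
    {for t, continuous (fun s => \sum_i F i s)}.
  move=> cF; have -> : (fun s => \sum_i F i s) = \sum_i F i.
    by apply/funext => s; rewrite fct_sumE.
  elim/big_ind : _ => [|f g cf cg|i _]; [exact: cvg_cst|exact: continuousD|exact: cF].
have -> : (fun s => qform (G (u s)) (derive1 u s)) = (fun s => \sum_j
    (\sum_i derive1 u s 0 i * G (u s) i j) * derive1 u s 0 j).
  apply/funext => s; rewrite /qform mxE; apply: eq_bigr => j _.
  by rewrite !mxE; congr (_ * _).
apply: (csum (fun j s => _)) => j; apply: continuousM; last exact: cc.
apply: (csum (fun i s => _)) => i; apply: continuousM; first exact: cc.
apply: (@continuous_comp _ _ _ u (fun y => G y i j)); first exact: C1_continuous.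
by apply: cG; exact: uD.
Qed.

Lemma continuous_at_itv (a b : K) (f : K -> K) :
  (forall t, a <= t <= b -> {for t, continuous f}) -> {within `[a, b], continuous f}.
Proof.
move=> cf; apply: continuous_in_subspaceT => t; rewrite inE/= in_itv/=; exact: cf.
Qed.

Lemma sub_curve_length D G u (a b : K) :
  (forall a b x, D x -> {for x, continuous (fun y => G y a b)}) ->
  is_C1_curve u -> (forall t, 0 <= t <= 1 -> D (u t)) ->
  0 <= a -> a <= b -> b <= 1 ->
  curve_length G (fun s => u (a + (b - a) * s)) =
  (\int[lebesgue_measure]_(t in `[a, b]) speed G u t)%:E.
Proof.
move=> cG uC uD a0 ab b1; have cs := speed_continuous cG uC uD.
have intE s : Num.sqrt (qform (G (u (a + (b - a) * s)))
    (derive1 (fun s => u (a + (b - a) * s)) s)) =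
    (b - a) * speed G u (a + (b - a) * s).
  have [_ ->] := derive1_affine (uC.1 (a + (b - a) * s)).
  rewrite /speed /qform linearZ/= -!scalemxAl -scalemxAr !mxE.
  rewrite mulrA sqrtrM ?sqr_ge0// -expr2 sqrtr_sqr ger0_norm// subr_ge0//.
rewrite /curve_length; under eq_integral do rewrite intE.
(* The substitution is strictly increasing only if [a < b]. *)
have [<-|a_b] := eqVneq a b.
  rewrite subrr; under eq_integral do rewrite mul0r.
  by rewrite integral0 set_itv1 Rintegral_set1.
have {}a_b : a < b by rewrite lt_neqAle a_b.
have cab : {within `[a, b], continuous (speed G u)}.
  by apply: continuous_at_itv => t /andP[at_ tb]; apply: cs; rewrite (le_trans a0)// (le_trans tb).
have fin : (\int[lebesgue_measure]_(t in `[a, b]) (speed G u t)%:E)%E \is a fin_num.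
  apply: integrable_fin_num => //.
  apply: continuous_compact_integrable => //; exact: segment_compact.
rewrite /Rintegral fineK//.
pose F s := a + (b - a) * s.
have F' : F^`()%classic = cst (b - a).
  by apply/funext => s; rewrite derive1E; have [_ ->] := is_derive_affine a (b - a) s.
have cF : continuous F.
  by move=> t; apply: cvgD; [exact: cvg_cst|apply: cvgM; [exact: cvg_cst|exact: cvg_id]].
have F0 : F 0 = a by rewrite /F mulr0 addr0.
have F1 : F 1 = b by rewrite /F mulr1 addrC subrK.
have := @integration_by_substitution_increasing K F (speed G u) 0 1 ler01.
rewrite F0 F1 F' => -> //.
- by apply: eq_integral => s _; rewrite mulrC.
- by move=> x y _ _ xy; rewrite ltrD2l ltr_pM2l// subr_gt0.
- by move=> x _; exact: cvg_cst.
- exact: is_cvg_cst.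
- exact: is_cvg_cst.
- split.
  + by move=> x _; have [] := is_derive_affine a (b - a) x.
  + exact/cvg_at_right_filter/cF.
  + exact/cvg_at_left_filter/cF.
Qed.

Lemma curve_length_split D G u (a : K) :
  (forall a b x, D x -> {for x, continuous (fun y => G y a b)}) ->
  is_C1_curve u -> (forall t, 0 <= t <= 1 -> D (u t)) -> 0 <= a <= 1 ->
  curve_length G u = (curve_length G (fun s => u (0 + (a - 0) * s)%R) +
    curve_length G (fun s => u (a + (1 - a) * s)%R))%E.
Proof.
move=> cG uC uD /andP[a0 a1]; rewrite !(sub_curve_length cG uC uD)//.
have {1}-> : u = (fun s => u (0 + (1 - 0) * s)).
  by apply/funext => s; rewrite subr0 mul1r add0r.
rewrite (sub_curve_length cG uC uD)// -EFinD; congr EFin.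
have si : lebesgue_measure.-integrable `[0, 1] (EFin \o speed G u).
  apply: continuous_compact_integrable; first exact: segment_compact.
  exact/continuous_at_itv/(speed_continuous cG uC uD).
rewrite -(@Rintegral_itv_obnd_cbnd K a (BRight 1)).
  rewrite -(@Rintegral_itvB K (speed G u) (BLeft 0) (BRight 1) a)//.
  by rewrite addrC subrK.
apply: integrableS si => //.
by apply: subset_itvr; rewrite bnd_simp.
Qed.

End Curves.

(** * Riemannian manifolds *)

Section RiemannianIsLength.
Context {K : realType} (n : nat) (M : metricType K) (g : riemannian n M).

Lemma tensor_continuous c : atlas g c -> forall a b x, chart_im c x ->
  {for x, continuous (fun y => tensor g c y a b)}.
Proof. by move=> ac a b x cx; have [h _] := tensor_smooth ac a b 0; exact: h. Qed.

Lemma chart_curve_cont (c : chart n M) (u : K -> 'rV[K]_n) : atlas g c ->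
  is_C1_curve u -> (forall t, 0 <= t <= 1 -> chart_im c (u t)) ->
  cont_on 0 1 (chart_inv c \o u).
Proof.
move=> ac uC uD t t01 W oW Wt.
have [_ _ _ _ /subspace_continuousP ci] := atlas_chart ac.
have : nbhs (u t) [set v | chart_im c v -> W (chart_inv c v)].
  exact: (ci _ (uD t t01) W (open_nbhs_nbhs (conj oW Wt))).
move=> /(@C1_continuous _ _ u uC t)[e /= e0 eW]; exists e => // s s01 st.
by apply: eW; [rewrite /= distrC|exact: uD].
Qed.

Lemma cont_on_mdist (a b : K) (f : K -> M) x : cont_on a b f ->
  cont_on a b (fun t => mdist x (f t)).
Proof.
move=> cf; apply: cont_on_real => t tab e e0.
have [] := cf t tab (ball (f t) e)^°.
- exact: open_interior.
- exact: nbhsx_ballx.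
move=> h h0 hW; exists h => // s sab st.
have /interior_subset := hW s sab st; rewrite ballEmdist/= => fts.
rewrite ler_norml; apply/andP; split.
  by have := metric_triangle x (f s) (f t); rewrite (metric_sym (f s)); lra.
by have := metric_triangle x (f t) (f s); lra.
Qed.

(** The cut is made in the first piece whose end is at distance at least [t] from [x0], by the
    intermediate value theorem. The reference point [x0] stays fixed while the start of the curve
    moves along in the induction. *)
Lemma pw_C1_curve_split x z l : pw_C1_curve (atlas g) (tensor g) x z l ->
  forall x0 t, mdist x0 x <= t <= mdist x0 z -> exists m l1 l2,
    [/\ pw_C1_curve (atlas g) (tensor g) x m l1,
        pw_C1_curve (atlas g) (tensor g) m z l2,
        l = (l1 + l2)%E & mdist x0 m = t].
Proof.
elim=> {x z l} [x|c u z l ac uC uim zl ih] x0 t.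
  move=> /andP[xt tx]; exists x, 0%E, 0%E; split; rewrite ?adde0//.
  - exact: pw_C1_nil.
  - exact: pw_C1_nil.
  - by apply/eqP; rewrite eq_le xt tx.
move=> /andP[xt tz].
have uD s : 0 <= s <= 1 -> chart_im c (u s).
  by move=> s01; apply: uim; exists s => //=; rewrite in_itv.
have [tu|ut] := leP t (mdist x0 (chart_inv c (u 1))); last first.
  have [m [l1 [l2 [h1 h2 -> h3]]]] := ih x0 t ltac:(by rewrite tz ltW).
  exists m, (curve_length (tensor g c) u + l1)%E, l2; split => //.
    exact: pw_C1_cons.
  by rewrite addeA.
have [|a /[dup] a01 /andP[a0 a1] fa] :=
    cont_on_IVT (v := t) ler01 (@cont_on_mdist _ _ _ x0 (chart_curve_cont ac uC uD)).
  by rewrite /= xt.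
have c1 := is_C1_affine 0 (a - 0) uC; have c2 := is_C1_affine a (1 - a) uC.
have i1 : (fun s => u (0 + (a - 0) * s)) @` `[0, 1] `<=` chart_im c.
  move=> _ [s + <-]; rewrite /= in_itv/= => /andP[s0 s1].
  by apply: uD; rewrite subr0 add0r mulr_ge0//= mulr_ile1.
have i2 : (fun s => u (a + (1 - a) * s)) @` `[0, 1] `<=` chart_im c.
  by move=> _ [s + <-]; rewrite /= in_itv/= => /andP[s0 s1]; apply: uD; nra.
exists (chart_inv c (u a)), (curve_length (tensor g c) (fun s => u (0 + (a - 0) * s)%R) + 0)%E,
  (curve_length (tensor g c) (fun s => u (a + (1 - a) * s)%R) + l)%E; split => //.
- have e0 : u 0 = u (0 + (a - 0) * 0) by rewrite mulr0 addr0.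
  have e1 : u a = u (0 + (a - 0) * 1) by rewrite mulr1 add0r subr0.
  by rewrite e0 e1; exact: pw_C1_cons ac c1 i1 (pw_C1_nil _ _ _).
- have e0 : u a = u (a + (1 - a) * 0) by rewrite mulr0 addr0.
  have e1 : u 1 = u (a + (1 - a) * 1) by rewrite mulr1 addrC subrK.
  by rewrite e0; apply: pw_C1_cons ac c2 i2 _; rewrite -e1.
- rewrite (@curve_length_split K n (chart_im c) (tensor g c) u a
    (tensor_continuous ac) uC uD a01).
  set Y := curve_length _ _; set Z := curve_length _ _.
  by move: Y Z => Y Z; rewrite adde0 addeA.
Qed.

(** An almost shortest curve is cut at distance [t] from [x]. Each of the two parts is at least as
    long as the distance of its ends. *)
Lemma riemannian_intermediate (x z : M) (t e : K) : 0 <= t <= mdist x z -> 0 < e ->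
  exists m, mdist x m = t /\ mdist m z <= mdist x z - t + e.
Proof.
move=> tx e0.
have : (ereal_inf [set l | pw_C1_curve (atlas g) (tensor g) x z l]
        < (mdist x z + e)%:E)%E.
  by rewrite -riemannian_dist /emdist lte_fin; lra.
move=> /ereal_inf_lt[l /= lP le].
have [|m [l1 [l2 [h1 h2 ll xm]]]] := pw_C1_curve_split lP (x0 := x) (t := t).
  by rewrite mdistxx.
exists m; split => //.
have d1 : ((mdist x m)%:E <= l1)%E.
  rewrite -[X in (X <= _)%E]/(emdist x m) (riemannian_dist g).
  exact: ereal_inf_lbound.
have d2 : ((mdist m z)%:E <= l2)%E.
  rewrite -[X in (X <= _)%E]/(emdist m z) (riemannian_dist g).
  exact: ereal_inf_lbound.
have := le_lt_trans (leeD d1 d2) (eq_ind _ (fun l => (l < _)%E) le _ ll).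
by rewrite -EFinD lte_fin xm; lra.
Qed.

Lemma riemannian_locally_compact (x : M) :
  exists2 e : K, 0 < e & exists C : set M, compact C /\
    forall y, mdist x y < e -> C y.
Proof.
have [c ac cx] := atlas_cover g x.
have [oc oi ck cm /subspace_continuousP ci] := atlas_chart ac.
have cix : chart_im c (chart_map c x) by exists x.
have /nbhs_ballP[e /= e0 eD] : nbhs (chart_map c x) (chart_im c).
  exact: open_nbhs_nbhs.
pose B := closed_ball (chart_map c x) (e / 2).
have e2 : 0 < e / 2 by rewrite divr_gt0.
have BD : B `<=` chart_im c.
  move=> v; rewrite /B closed_ballE// => xv; apply: eD.
  by rewrite -ball_normE /=; apply: (le_lt_trans xv); lra.
have cB : compact B.
  apply: bounded_closed_compact; last exact: closed_ball_closed.
  exists (`|chart_map c x| + e); split; first exact: num_real.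
  move=> r hr v; rewrite /B closed_ballE// /closed_ball_/= => xv.
  have -> : v = chart_map c x - (chart_map c x - v) by rewrite opprB addrC subrK.
  by apply: (le_trans (ler_normB _ _)); lra.
have : nbhs x [set y | chart_dom c y -> B (chart_map c y)].
  move/subspace_continuousP : cm => /(_ x cx B); apply.
  apply: filterS (nbhsx_ballx (chart_map c x) _ e2); exact: subset_closed_ball.
have : nbhs x (chart_dom c) by exact: open_nbhs_nbhs.
move=> h1 h2; have /nbhs_ballP[d /= d0 dP] : nbhs x
  (chart_dom c `&` [set y | chart_dom c y -> B (chart_map c y)]).
  exact: filterI.
exists d => //; exists (chart_inv c @` B); split.
  apply: continuous_compact => //.
  apply/subspace_continuousP => v Bv.
  apply: cvg_trans (ci v (BD v Bv)).
  by apply: cvg_app; apply: within_subset.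
move=> y xy; have [cy By] : (chart_dom c `&` [set y | chart_dom c y -> B (chart_map c y)]) y.
  by apply: dP; rewrite ballEmdist.
by exists (chart_map c y); [exact: By|exact: ck].
Qed.

End RiemannianIsLength.

(** * Hopf-Rinow *)

Section HopfRinow.
Context {K : realType} (M : metricType K).
Hypothesis M_int : forall (x z : M) (t e : K), 0 <= t <= mdist x z -> 0 < e ->
  exists m, mdist x m = t /\ mdist m z <= mdist x z - t + e.
Hypothesis M_lc : forall x : M, exists2 e : K, 0 < e &
  exists C : set M, compact C /\ forall y, mdist x y < e -> C y.
Hypothesis M_complete : complete_metric M.

Definition tot_bounded (A : set M) : Prop := forall e : K, 0 < e ->
  exists s : seq M, forall y, A y -> exists2 c, c \in s & mdist c y <= e.

Notation B p r := [set y : M | mdist p y <= r].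

Lemma tot_boundedS (A A' : set M) : A `<=` A' -> tot_bounded A' -> tot_bounded A.
Proof. by move=> AA tA e /tA[s sP]; exists s => y /AA; exact: sP. Qed.

Lemma tot_bounded_in (A : set M) : tot_bounded A -> forall e : K, 0 < e ->
  exists s : seq M, (forall c, c \in s -> A c) /\
    forall y, A y -> exists2 c, c \in s & mdist c y <= e.
Proof.
move=> tA e e0; have e2 : 0 < e / 2 by rewrite divr_gt0.
have [s sP] := tA _ e2.
have : forall c, exists c', (A c' /\ mdist c c' <= e / 2) \/
    forall y, A y -> ~ mdist c y <= e / 2.
  move=> c; have [[y [Ay cy]]|no] := pselect (exists y, A y /\ mdist c y <= e / 2).
    by exists y; left.
  by exists c; right => y Ay cy; apply: no; exists y.
move=> /choice[f fP].
exists [seq f c | c <- s & `[< A (f c) >]]; split.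
  by move=> _ /mapP[c + ->]; rewrite mem_filter => /andP[/asboolP].
move=> y Ay; have [c cs cy] := sP y Ay.
have [[Af cf]|no] := fP c; last by have := no y Ay.
exists (f c); first by apply: map_f; rewrite mem_filter cs andbT; exact/asboolP.
by have := metric_triangle (f c) c y; rewrite (metric_sym (f c) c); lra.
Qed.

Lemma compact_tot_bounded (A : set M) : compact A -> tot_bounded A.
Proof.
move=> /compact_near_coveringP cA e e0.
(* The filter of all sufficiently large finite sets of centers. *)
pose F := [set P : set (seq M) | exists s0 : seq M, forall s, {subset s0 <= s} -> P s].
have FF : Filter F.
  split; first by exists [::].
    move=> P Q [s1 P1] [s2 P2]; exists (s1 ++ s2) => s ss.
    by split; [apply: P1|apply: P2] => x xs; apply: ss; rewrite mem_cat xs ?orbT.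
  by move=> P Q PQ [s0 P0]; exists s0 => s /P0/PQ.
have [x Ax|s0 s0P] := cA (seq M) F (fun s x => exists2 c, c \in s & mdist c x <= e) FF.
  exists (ball x e, [set s : seq M | x \in s]); first split.
  - exact: nbhsx_ballx.
  - by exists [:: x] => s; apply; rewrite inE.
  by move=> [y s] /= [xy xs]; exists x => //; move: xy; rewrite ballEmdist => /ltW.
by exists s0; exact: s0P.
Qed.

(** An ultrafilter on the ball contains one of finitely many small balls at every scale, so it is
    Cauchy and converges by completeness. *)
Lemma tot_bounded_compact p r : tot_bounded (B p r) -> compact (B p r).
Proof.
move=> tb; rewrite compact_ultra => F FU FB.
have Fc : cauchy F.
  apply: cauchy_exP => e e0; have e2 : 0 < e / 2 by rewrite divr_gt0.
  have [s sP] := tb _ e2.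
  have : F [set y | exists2 c, c \in s & mdist c y <= e / 2] by exact: filterS FB.
  elim: s {sP} => [|c s ih] h; first by have [y []] := filter_ex h.
  have [cF|cF] := in_ultra_setVsetC [set y | mdist c y <= e / 2] FU.
    exists c; apply: filterS cF => y /= cy; rewrite ballEmdist/=; lra.
  apply: ih; apply: filterS2 h cF => y [c' + c'y] cy.
  by rewrite inE => /predU1P[cc|c's]; [rewrite -cc in cy|exists c'].
have [x Fx] := M_complete ultra_proper Fc.
exists x; split => //=; apply/ler_addgt0Pr => e e0.
have Fxe : F (ball x e) by apply: Fx; exact: nbhsx_ballx.
have [y [/= py]] := filter_ex (filterI FB Fxe); rewrite ballEmdist/= => xy.
by have := metric_triangle p y x; rewrite (metric_sym y); lra.
Qed.

Lemma step_towards (p y : M) (s e : K) : 0 <= s -> 0 < e -> exists m,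
  mdist p m <= s /\ mdist m y <= Num.max 0 (mdist p y - s) + e.
Proof.
move=> s0 e0; have [ys|sy] := leP (mdist p y) s.
  exists y; split => //; rewrite mdistxx.
  have : 0 <= Num.max 0 (mdist p y - s) by rewrite le_max lexx.
  lra.
have [|m [pm my]] := @M_int p y s e _ e0; first by rewrite s0 ltW.
exists m; rewrite pm; split => //; apply: (le_trans my).
by rewrite lerD2r le_max lexx orbT.
Qed.

Lemma tot_bounded_cball_lt p r : 0 <= r ->
  (forall s, 0 <= s -> s < r -> tot_bounded (B p s)) -> tot_bounded (B p r).
Proof.
move=> r0 tb e e0.
have [re|er] := ltP r (e / 4).
  by exists [:: p] => y /= py; exists p; rewrite ?inE//; lra.
have e4 : 0 < e / 4 by rewrite divr_gt0.
have [s sP] := tb (r - e / 4) ltac:(lra) ltac:(lra) _ e4.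
exists s => y /= py.
have [|m [pm my]] := @step_towards p y (r - e / 4) (e / 4) _ e4; first by lra.
have [c cs cm] := sP m pm; exists c => //.
have := metric_triangle c m y.
have : Num.max 0 (mdist p y - (r - e / 4)) <= e / 4 by rewrite ge_max; lra.
lra.
Qed.

Lemma tot_bounded_cball_gt p r : 0 <= r -> tot_bounded (B p r) ->
  exists2 h : K, 0 < h & tot_bounded (B p (r + h)).
Proof.
move=> r0 tb.
have /compact_near_coveringP nc := tot_bounded_compact tb.
have [] := nc nat \oo (fun k x => tot_bounded (B x k.+1%:R^-1)) _.
  move=> x _; have [e e0 [C [cC CP]]] := M_lc x.
  have e2 : 0 < e / 2 by rewrite divr_gt0.
  near=> x' k.
    have xx : mdist x x' < e / 2.
      have : ball x (e / 2) x' by near: x'; exact: nbhsx_ballx.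
      by rewrite ballEmdist.
    have ke : k.+1%:R^-1 < e / 2.
      by near: k; exact: (near_infty_natSinv_lt (PosNum e2)).
    apply: tot_boundedS (compact_tot_bounded cC) => y /= xy; apply: CP.
    apply: (le_lt_trans (metric_triangle x x' y)).
    by rewrite (splitr e) ltrD// (le_lt_trans xy).
move=> k _ /(_ _ (leqnn k)) kP; set h : K := k.+1%:R^-1.
have h0 : 0 < h by rewrite invr_gt0 ltr0n.
(* By compactness one radius [h] works for all centers in the ball. A point of the larger ball is
   within [h / 2] of the smaller one, and a net of size [h / 4] there leaves it within [h] of a
   center. *)
exists (h / 4) => [|e e0]; first by rewrite divr_gt0.
have [|s [sA sP]] := tot_bounded_in tb (e := h / 4); first by rewrite divr_gt0.
have : forall c, exists t : seq M, B p r c -> forall y, B c h y ->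
    exists2 x, x \in t & mdist x y <= e.
  move=> c; have [cB|] := pselect (B p r c); last by exists [::].
  by have [t tP] := kP c cB e e0; exists t.
move=> /choice[t tP]; exists (flatten [seq t c | c <- s]) => y /= py.
have [|m [pm my]] := @step_towards p y r (h / 4) r0; first by rewrite divr_gt0.
have [c cs cm] := sP m pm.
have [|x xt xy] := tP c (sA c cs) y.
  have : Num.max 0 (mdist p y - r) <= h / 4 by rewrite ge_max; lra.
  by move=> hm; have := metric_triangle c m y => /=; lra.
by exists x => //; apply/flattenP; exists (t c) => //; exact: map_f.
Unshelve. all: by end_near.
Qed.

(** If some ball failed, the supremum of the radii with totally bounded balls would be such a radius
    by approximation from below, and local compactness would allow a larger one. *)
Theorem hopf_rinow p r : tot_bounded (B p r).
Proof.
have [r0|r0] := ltP r 0.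
  move=> e e0; exists [::] => y /=; have := mdist_ge0 p y; lra.
apply: contrapT => ntb.
pose S := [set s : K | 0 <= s /\ tot_bounded (B p s)].
have S0 : S 0.
  split => // e e0; exists [:: p] => y /= py; exists p; rewrite ?inE//; lra.
have Sub s : S s -> s <= r.
  move=> [s0 ts]; rewrite leNgt; apply/negP => rs; apply: ntb.
  apply: tot_boundedS ts => y /= yr; lra.
have supS : has_sup S by split; [exists 0|exists r].
have sup0 : 0 <= sup S by apply: ub_le_sup => //; case: supS.
have tsup : tot_bounded (B p (sup S)).
  apply: tot_bounded_cball_lt => // s s0 ss.
  have e0 : 0 < sup S - s by rewrite subr_gt0.
  have [u [u0 tu]] := sup_adherent e0 supS; rewrite opprB addrC subrK => su.
  by apply: tot_boundedS tu => y /= ys; lra.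
have [h h0 th] := tot_bounded_cball_gt sup0 tsup.
have : sup S + h <= sup S.
  apply: ub_le_sup; first by case: supS.
  by split => //; lra.
lra.
Qed.

Lemma seq_ultra_limit (U : set_system nat) (p : M) (r : K) (x : nat -> M) :
  UltraFilter U -> (forall k, mdist p (x k) <= r) ->
  exists l, forall e : K, 0 < e -> U [set k | mdist l (x k) < e].
Proof.
move=> UU xr.
have [|l [_ lP]] := tot_bounded_compact (@hopf_rinow p r) (F := x @ U) _.
  by apply: (@filterS _ U _ setT) => [k _|]; [exact: xr|exact: filterT].
exists l => e e0.
have [//|Uc] := in_ultra_setVsetC [set k | mdist l (x k) < e] UU.
have [||y [/= y1 y2]] := lP (~` ball l e) (ball l e).
- by rewrite /fmap/=; apply: filterS Uc => i; rewrite /= ballEmdist.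
- exact: nbhsx_ballx.
- by [].
Qed.

Lemma exact_intermediate (x z : M) (t : K) : 0 <= t <= mdist x z ->
  exists m, mdist x m <= t /\ mdist m z <= mdist x z - t.
Proof.
move=> tx; have [U [UU UF]] := ultraFilterLemma (eventually_filter : ProperFilter \oo).
have : forall k : nat, exists m, mdist x m = t /\
    mdist m z <= mdist x z - t + k.+1%:R^-1.
  by move=> k; apply: M_int => //; rewrite invr_gt0 ltr0n.
move=> /choice[m mP].
have [|l lP] := @seq_ultra_limit U x t m UU; first by move=> k; case: (mP k) => ->.
exists l; split; apply/ler_addgt0Pr => e e0.
  have [k /= lk] := filter_ex (lP e e0).
  have := metric_triangle x (m k) l; rewrite (metric_sym (m k)).
  by case: (mP k) => -> _; lra.
have e2 : 0 < e / 2 by rewrite divr_gt0.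
have Uk : U [set k | k.+1%:R^-1 < e / 2].
  exact/UF/(near_infty_natSinv_lt (PosNum e2)).
have [k [/= lk ke]] := filter_ex (filterI (lP _ e2) Uk).
have {}ke : k.+1%:R^-1 < e / 2 :> K by exact: ke.
have := metric_triangle l (m k) z; case: (mP k) => _.
move: (k.+1%:R^-1) ke => i; lra.
Qed.

(** A step function, in general discontinuous: [N] steps towards [z], each at most the [N]-th part
    of the distance. Rounding both times down costs at most one step, the term [N%:R^-1]. *)
Lemma approx_geodesic (x z : M) (N : nat) : (0 < N)%N -> exists f : K -> M,
  [/\ f 0 = x, f 1 = z & forall s t, 0 <= s -> s <= t -> t <= 1 ->
    mdist (f s) (f t) <= mdist x z * (t - s + N%:R^-1)].
Proof.
move=> N0; set D := mdist x z.
have D0 : 0 <= D by exact: mdist_ge0.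
have NR : 0 < N%:R :> K by rewrite ltr0n.
have Ni : N%:R * N%:R^-1 = 1 :> K by rewrite divff// gt_eqF.
pose I : K := N%:R^-1; have I0 : 0 < I by rewrite invr_gt0.
(* The alternative on the index makes the step a total function. When less than one step remains, it
   goes to [z]. *)
have : forall jm : nat * M, exists m', mdist jm.2 z <= D * (1 - jm.1%:R * I) ->
    mdist jm.2 m' <= D * I /\ mdist m' z <= D * (1 - jm.1.+1%:R * I) \/ (N <= jm.1)%N.
  move=> [j m] /=; have [jN|jN] := ltnP j N; last by exists m; right.
  have [mz|mz] := leP (mdist m z) (D * I).
    exists z => _; left; split => //; rewrite mdistxx mulr_ge0// subr_ge0.
    by rewrite ler_pdivrMr// mul1r ler_nat.
  have [|m' [m1 m2]] := @exact_intermediate m z (D * I).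
    by rewrite mulr_ge0 ?(ltW I0)// ltW.
  exists m' => mD; left; split => //; apply: (le_trans m2).
  by rewrite -natr1; lra.
move=> /choice[step stepP].
pose c := fix c j := if j is j'.+1 then step (j', c j') else x.
have cz j : (j <= N)%N -> mdist (c j) z <= D * (1 - j%:R * I).
  elim: j => [|j ih] jN; first by rewrite mul0r subr0 mulr1.
  have [[_]//|] := stepP (j, c j) (ih (ltnW jN)).
  by rewrite /= leqNgt jN.
have cs j : (j < N)%N -> mdist (c j) (c j.+1) <= D * I.
  move=> jN; have [[]//|] := stepP (j, c j) (cz j (ltnW jN)).
  by rewrite /= leqNgt jN.
have cd i k : (i + k <= N)%N -> mdist (c i) (c (i + k)%N) <= D * I * k%:R.
  elim: k => [|k ih] ikN; first by rewrite addn0 mdistxx mulr0.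
  rewrite addnS in ikN *.
  have := metric_triangle (c i) (c (i + k)%N) (c (i + k).+1).
  have := ih (ltnW ikN); have := cs _ ikN; rewrite -[k.+1%:R]natr1; lra.
have cN : c N = z.
  apply: mdist_positivity; apply/eqP; rewrite eq_le mdist_ge0 andbT.
  by have := cz N (leqnn N); rewrite Ni subrr mulr0.
exists (fun t => c (Num.truncn (t * N%:R))); split.
- by rewrite mul0r truncn0.
- by rewrite mul1r natrK cN.
- move=> s t s0 st t1.
  have t0 := le_trans s0 st.
  have sN0 : 0 <= s * N%:R by rewrite mulr_ge0// ltW.
  have tN0 : 0 <= t * N%:R by rewrite mulr_ge0// ltW.
  have /andP[a1 a2] := truncn_itv sN0; have /andP[b1 b2] := truncn_itv tN0.
  set a := Num.truncn (s * _) in a1 a2 *; set b := Num.truncn (t * _) in b1 b2 *.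
  have ab : (a <= b)%N by rewrite /b truncn_ge_nat//; apply: (le_trans a1); rewrite ler_wpM2r// ltW.
  have bN : (b <= N)%N by rewrite -(ler_nat K); apply: (le_trans b1); rewrite ler_piMl// ltW.
  have := cd a (b - a)%N; rewrite subnKC// => /(_ bN) /le_trans; apply.
  rewrite natrB// -mulrA ler_wpM2l//.
  have -> : t - s + N%:R^-1 = I * (t * N%:R - s * N%:R + 1).
    by rewrite /I; field; rewrite gt_eqF.
  by rewrite ler_wpM2l ?ltW//; move: a2; rewrite -natr1; lra.
Qed.

(** The pointwise ultralimit of the step functions, which exists because bounded closed balls are
    compact; the rounding error vanishes in the limit. *)
Theorem geodesic (x z : M) : exists f : K -> M, [/\ f 0 = x, f 1 = z &
  forall s t, 0 <= s -> s <= t -> t <= 1 ->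
    mdist (f s) (f t) <= mdist x z * (t - s)].
Proof.
have [U [UU UF]] := ultraFilterLemma (eventually_filter : ProperFilter \oo).
have : forall k : nat, exists f : K -> M,
  [/\ f 0 = x, f 1 = z & forall s t, 0 <= s -> s <= t -> t <= 1 ->
    mdist (f s) (f t) <= mdist x z * (t - s + k.+1%:R^-1)].
  by move=> k; exact: approx_geodesic.
move=> /choice[f fP].
have D0 : 0 <= mdist x z by exact: mdist_ge0.
have : forall t, exists l, 0 <= t <= 1 ->
    forall e : K, 0 < e -> U [set k | mdist l (f k t) < e].
  move=> t; have [/andP[t0 t1]|] := boolP (0 <= t <= 1); last by exists x.
  have [|l lP] := @seq_ultra_limit U x (mdist x z * 2) (f ^~ t) UU.
    move=> k; have [f0 _ fd] := fP k; rewrite -{1}f0.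
    apply: (le_trans (fd 0 t (lexx _) t0 t1)); rewrite ler_wpM2l//.
    by rewrite subr0 -[2%R]/(1 + 1) lerD// invf_le1 ?ler1n// ltr0n.
  by exists l.
move=> /choice[l lP].
have b0 : 0 <= (0 : K) <= 1 by rewrite lexx ler01.
have b1 : 0 <= (1 : K) <= 1 by rewrite lexx ler01.
exists l; split.
- apply: mdist_positivity; apply/eqP; rewrite eq_le mdist_ge0 andbT.
  apply/ler_addgt0Pr => e e0; have [k /=] := filter_ex (lP 0 b0 e e0).
  by case: (fP k) => -> _ _; lra.
- apply: mdist_positivity; apply/eqP; rewrite eq_le mdist_ge0 andbT.
  apply/ler_addgt0Pr => e e0; have [k /=] := filter_ex (lP 1 b1 e e0).
  by case: (fP k) => _ -> _; lra.
- move=> s t s0 st t1; apply/ler_addgt0Pr => e e0.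
  have e4 : 0 < e / 4 by rewrite divr_gt0.
  have Uk : U [set k | mdist x z * k.+1%:R^-1 < e / 4].
    have D1 : 0 < mdist x z + 1 by lra.
    apply: UF; apply: filterS (near_infty_natSinv_lt (PosNum (divr_gt0 e4 D1))).
    move=> k /=; rewrite ltr_pdivlMr// mulrC => /le_lt_trans; apply.
    by rewrite mulrDl mul1r lerDl invr_ge0.
  have s01 : 0 <= s <= 1 by rewrite s0 (le_trans st).
  have t01 : 0 <= t <= 1 by rewrite t1 (le_trans s0).
  have [k [/= [h1 h2] h3]] :=
    filter_ex (filterI (filterI (lP s s01 _ e4) (lP t t01 _ e4)) Uk).
  have {}h3 : mdist x z * k.+1%:R^-1 < e / 4 by exact: h3.
  have [_ _ fd] := fP k; have := fd s t s0 st t1; rewrite mulrDr.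
  have := metric_triangle (l s) (f k s) (l t).
  have := metric_triangle (f k s) (f k t) (l t).
  rewrite (metric_sym (f k t) (l t)).
  by move: (mdist x z * k.+1%:R^-1) h3 => X; lra.
Qed.

End HopfRinow.

(** * Total boundedness of intrinsic balls *)

Section Nets.
Context {K : realType}.

(* Centers are indexed by [nat], since [S] need not have decidable equality. *)
Definition has_net (S : Type) (A : set S) (d : S -> S -> \bar K) (e : K)
    (N : nat) : Prop :=
  exists c : nat -> S, (forall j, A (c j)) /\
    forall y, A y -> exists2 j, (j < N)%N & (d (c j) y <= e%:E)%E.

(** Center and point are each moved by [h]. The embeddings are arbitrary so that either summand of a
    disjoint union can be the source. *)
Lemma has_net_transfer (S T W : Type) (A : set S) (dA : S -> S -> \bar K)
    (B : set T) (dB : T -> T -> \bar K) (rho : W -> W -> \bar K)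
    (f : S -> W) (g : T -> W) (e h : K) (N : nat) (b : T) :
  is_epseudometric (f @` A `|` g @` B) rho ->
  (forall x y, A x -> A y -> rho (f x) (f y) = dA x y) ->
  (forall x y, B x -> B y -> rho (g x) (g y) = dB x y) ->
  (forall x, A x -> exists2 y, B y & (rho (f x) (g y) <= h%:E)%E) ->
  (forall y, B y -> exists2 x, A x & (rho (f x) (g y) <= h%:E)%E) ->
  has_net A dA e N -> B b -> has_net B dB (e + 2 * h) N.
Proof.
move=> [_ _ rC rT] rA rB AB BA [c [cA cP]] Bb.
have : forall j, exists y, B y /\ (rho (f (c j)) (g y) <= h%:E)%E.
  by move=> j; have [y By h1] := AB _ (cA j); exists y.
move=> /choice[w wP]; exists w; split; first by move=> j; case: (wP j).
move=> y By; have [x Ax xy] := BA y By; have [j jN cx] := cP x Ax.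
have [Bw cw] := wP j; exists j => //.
have Df u : A u -> (f @` A `|` g @` B) (f u) by move=> Au; left; exists u.
have Dg u : B u -> (f @` A `|` g @` B) (g u) by move=> Bu; right; exists u.
rewrite -rB//; apply: (le_trans (rT _ (f x) _ (Dg _ Bw) (Df _ Ax) (Dg _ By))).
apply: (@le_trans _ _ ((rho (g (w j)) (f (c j)) + rho (f (c j)) (f x)) +
    rho (f x) (g y))%E).
  by apply: leeD2r; exact: rT (Dg _ Bw) (Df _ (cA j)) (Df _ Ax).
rewrite (rC (g _)); [|exact: Dg|exact: Df]; rewrite rA//.
apply: (le_trans (leeD (leeD cw cx) xy)).
by rewrite -!EFinD lee_fin; lra.
Qed.

Lemma gh_dist_lt_embedding (S T : Type) (A : set S) (dA : S -> S -> \bar K)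
    (B : set T) (dB : T -> T -> \bar K) (h : K) : (gh_dist A dA B dB < h%:E)%E ->
  exists rho, [/\ gh_admissible A dA B dB rho,
    forall x, A x -> exists2 y, B y & (rho (inl x) (inr y) <= h%:E)%E &
    forall y, B y -> exists2 x, A x & (rho (inl x) (inr y) <= h%:E)%E].
Proof.
move=> /ereal_inf_lt[_ [rho adm <-] /ereal_inf_lt[_ [k [k0 h1 h2] <-]]].
rewrite lte_fin => kh; exists rho; split => //.
  move=> x Ax; have [|_ [y By <-] xy] := h1 (inl x); first by exists x.
  by exists y => //; apply: (le_trans xy); rewrite lee_fin ltW.
move=> y By; have [|_ [x Ax <-] xy] := h2 (inr y); first by exists y.
by exists x => //; apply: (le_trans xy); rewrite lee_fin ltW.
Qed.

(** A net of a single space close to the limit passes to the limit, and from there to all later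
    spaces, with the same number of centers. Two transfers turn [e / 8] into [5 * e / 8]. *)
Lemma gh_cvg_uniform_net (S : nat -> Type) (A : forall i, set (S i))
    (dA : forall i, S i -> S i -> \bar K) (T : Type) (B : set T)
    (dB : T -> T -> \bar K) (a : forall i, S i) :
  gh_cvg A dA B dB -> (forall i, A i (a i)) ->
  (forall i (e : K), 0 < e -> exists N, has_net (A i) (dA i) e N) ->
  forall e : K, 0 < e -> exists N, \forall i \near \oo, has_net (A i) (dA i) e N.
Proof.
move=> cv Aa nets e e0.
have h0 : 0 < e / 8 by rewrite divr_gt0.
have nh : \forall i \near \oo, (gh_dist (A i) (dA i) B dB < (e / 8)%:E)%E.
  apply: (cv [set x | (x < (e / 8)%:E)%E]).
  apply: open_nbhs_nbhs; split; last by rewrite /= lte_fin.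
  exact: open_ereal_lt_ereal.
have [I _ IP] := nh.
have /gh_dist_lt_embedding[rho [[repm rA rB] AB BA]] := IP I (leqnn I).
have [N AN] := nets I _ h0.
have [b Bb _] := AB _ (Aa I).
have BN := has_net_transfer repm rA rB AB BA AN Bb.
exists N; apply: filterS nh => i /gh_dist_lt_embedding.
move=> [rho' [[repm' rA' rB'] AB' BA']].
have repm'' : is_epseudometric (inr @` B `|` inl @` A i) rho' by rewrite setUC.
have [rho0 rho1 rC _] := repm'.
have flip x y : A i x -> B y -> rho' (inr y) (inl x) = rho' (inl x) (inr y).
  by move=> Ax By; apply: rC; [right; exists y|left; exists x].
have [||c [cA cP]] := has_net_transfer (h := e / 8) repm'' rB' rA' _ _ BN (Aa i).
- by move=> y By; have [x Ax xy] := BA' y By; exists x => //; rewrite flip.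
- by move=> x Ax; have [y By xy] := AB' x Ax; exists y => //; rewrite flip.
 exists c; split => // y /cP[j jN cy]; exists j => //.
by apply: (le_trans cy); rewrite lee_fin; lra.
Qed.

End Nets.

(** * Nets of a ball for its intrinsic metric *)

Section IntrinsicTotallyBounded.
Context {K : realType} (M : metricType K).
Hypothesis M_tb : forall (p : M) (r : K), tot_bounded [set y : M | mdist p y <= r].
Hypothesis M_geo : forall (x z : M), exists f : K -> M, [/\ f 0 = x, f 1 = z &
  forall s t, 0 <= s -> s <= t -> t <= 1 ->
    mdist (f s) (f t) <= mdist x z * (t - s)].

Lemma lipschitz_cont (f : K -> M) (D : K) : 0 <= D ->
  (forall s t, 0 <= s -> s <= t -> t <= 1 -> mdist (f s) (f t) <= D * (t - s)) ->
  cont_on 0 1 f.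
Proof.
move=> D0 fD t /andP[t0 t1] W oW Wt.
have /nbhs_ballP[e /= e0 eW] : nbhs (f t) W by exact: open_nbhs_nbhs.
have D1 : 0 < D + 1 by lra.
exists (e / (D + 1)); first by rewrite divr_gt0.
move=> s /andP[s0 s1]; rewrite ltr_pdivlMr// => st; apply: eW.
rewrite ballEmdist/=.
have [le_st|lt_ts] := leP s t.
  rewrite metric_sym; apply: (le_lt_trans (fD s t s0 le_st t1)).
  by move: st; rewrite distrC ger0_norm ?subr_ge0//; nra.
have le_ts := ltW lt_ts; apply: (le_lt_trans (fD t s t0 le_ts s1)).
by move: st; rewrite ger0_norm ?subr_ge0//; nra.
Qed.

Lemma lipschitz_intrinsic (A : set M) (f : K -> M) (D a b : K) :
  (forall s t, 0 <= s -> s <= t -> t <= 1 -> mdist (f s) (f t) <= D * (t - s)) ->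
  0 <= D -> 0 <= a -> a <= b -> b <= 1 -> (forall t, a <= t <= b -> A (f t)) ->
  (intrinsic_dist (@emdist K M) A (f a) (f b) <= (D * (b - a))%:E)%E.
Proof.
move=> fD D0 a0 ab b1 fA.
apply: (le_trans (path_dist_le_vlen (@emdist_epm K M) id ab _ fA)).
  exact: cont_onW (lipschitz_cont D0 fD).
have key s c : a <= c -> path <=%R c s -> last c s = b ->
    (vsum (@emdist K M) f c s <= (D * (b - c))%:E)%E.
  elim: s c => [|x s ih] c /= ac; first by move=> _ ->; rewrite subrr mulr0.
  move=> /andP[cx xs] xb.
  have xb' : x <= b by rewrite -xb; exact: path_le_last.
  apply: (@le_trans _ _ ((D * (x - c))%:E + (D * (b - x))%:E)%E).
    apply: leeD; last by apply: ih => //; exact: le_trans cx.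
    rewrite /emdist lee_fin; apply: fD => //; first exact: le_trans ac.
    exact: le_trans b1.
  by rewrite -EFinD lee_fin -mulrDr; apply: ler_wpM2l => //; lra.
by apply: vlen_leP => s; exact: key.
Qed.

(* A minimal geodesic towards the center moves a point of the ball away from
   the boundary, where the intrinsic metric is locally that of [M]. *)
Lemma intrinsic_net (p : M) (r e : K) : 0 < r -> 0 < e ->
  exists N, has_net (cball (@emdist K M) p r)
    (intrinsic_dist (@emdist K M) (cball (@emdist K M) p r)) e N.
Proof.
move=> r0 e0; set A := cball _ p r; set d := intrinsic_dist _ _.
have AE y : A y <-> mdist p y <= r by rewrite /A /cball/= /emdist lee_fin.
have pA : A p by apply/AE; rewrite mdistxx ltW.
have e3 : 0 < e / 3 by rewrite divr_gt0.
have geoA y : A y -> exists f : K -> M, [/\ f 0 = p, f 1 = y,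
    forall s t, 0 <= s -> s <= t -> t <= 1 ->
      mdist (f s) (f t) <= mdist p y * (t - s) &
    forall t, 0 <= t <= 1 -> mdist p (f t) <= mdist p y * t].
  move=> /AE py; have [f [f0 f1 fd]] := M_geo p y; exists f; split => //.
  move=> t /andP[t0 t1]; have := fd 0 t (lexx _) t0 t1.
  by rewrite f0 subr0.
have [re|er] := leP r (e / 3).
  exists 1%N, (fun=> p); split => // y Ay; exists 0%N => //.
  have [f [f0 f1 fd fp]] := geoA y Ay; have /AE py := Ay.
  rewrite -f1 -{1}f0.
  apply: (le_trans (lipschitz_intrinsic (D := mdist p y) fd _ _ _ _ _)) => //.
  - exact: mdist_ge0.
  - move=> t t01; apply/AE; apply: (le_trans (fp t t01)).
    by have := mdist_ge0 p y; nra.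
  - by rewrite lee_fin; lra.
have [s [sA sP]] := tot_bounded_in (M_tb p (r - e / 3)) e3.
exists (size s), (fun j => if (j < size s)%N then nth p s j else p); split.
  move=> j; case: ifP => // js; apply/AE.
  by have /= := sA _ (mem_nth p js); lra.
move=> y Ay; have /AE py := Ay.
have [m [pm Am my]] : exists m, [/\ mdist p m <= r - e / 3, A m &
    (d m y <= (e / 3)%:E)%E].
  have [pe|ep] := leP (mdist p y) (r - e / 3).
    exists y; split => //; rewrite /d -[intrinsic_dist _ _ _ _]/(path_dist _ id _ _ _).
    by rewrite path_distxx ?lee_fin ?ltW//; exact: emdist_epm.
  have [f [f0 f1 fd fp]] := geoA y Ay.
  have D0 : 0 < mdist p y by lra.
  (* The time at which the geodesic from [p] to [y] reaches radius [r - e / 3]; at most [e / 3] of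
     it remains. *)
  pose t := (r - e / 3) / mdist p y.
  have Dt : mdist p y * t = r - e / 3 by rewrite mulrC divfK// gt_eqF.
  have t01 : 0 <= t <= 1.
    apply/andP; split; last by rewrite ler_pdivrMr// mul1r ltW.
    by apply: divr_ge0; lra.
  have /andP[t0 t1] := t01.
  have pft : mdist p (f t) <= r - e / 3.
    by apply: (le_trans (fp t t01)); rewrite Dt.
  exists (f t); split => //; first by apply/AE; lra.
  rewrite -f1; apply: (le_trans (lipschitz_intrinsic fd _ t0 t1 (lexx _) _)).
  - exact: mdist_ge0.
  - move=> u /andP[tu u1]; apply/AE; apply: (le_trans (fp u _)).
      by rewrite u1 (le_trans t0).
    by nra.
  - by rewrite lee_fin mulrBr mulr1 Dt; lra.
have [c cs cm] := sP m pm; have pc := sA c cs.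
exists (index c s); first by rewrite index_mem.
rewrite index_mem cs nth_index//.
have Ac : A c by apply/AE; move: pc => /=; lra.
apply: (@le_trans _ _ (d c m + d m y)%E).
  exact: (path_dist_triangle (@emdist_epm K M) id A).
rewrite (_ : e = e / 3 * 2 + e / 3); last by field.
rewrite EFinD; apply: leeD => //.
(* This geodesic has length at most [e / 3] and both its ends are at least [e / 3] inside the ball,
   so it does not leave the ball and bounds the intrinsic distance. *)
have [h [h0 h1 hd]] := M_geo c m.
rewrite -h1 -{1}h0; apply: (le_trans (lipschitz_intrinsic (D := mdist c m) hd _ _ _ _ _)) => //.
- exact: mdist_ge0.
- move=> t /andP[t0 t1]; apply/AE.
  have := metric_triangle p c (h t); have := metric_triangle p m (h t).
  have := hd 0 t (lexx _) t0 t1; have := hd t 1 t0 t1 (lexx _).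
  rewrite h0 h1 (metric_sym (h t)) subr0; move: pc => /=.
  have := mdist_ge0 c m.
  nra.
- by rewrite subr0 mulr1 lee_fin; lra.
Qed.

End IntrinsicTotallyBounded.

Section RiemannianBalls.
Context {K : realType} (n : nat) (M : metricType K) (g : riemannian n M).
Hypothesis M_complete : complete_metric M.

Lemma riemannian_intrinsic_net (p : M) (r e : K) : 0 < r -> 0 < e ->
  exists N, has_net (cball (@emdist K M) p r)
    (intrinsic_dist (@emdist K M) (cball (@emdist K M) p r)) e N.
Proof.
have M_int := riemannian_intermediate g; have M_lc := riemannian_locally_compact g.
apply: intrinsic_net; first exact: hopf_rinow.
exact: geodesic.
Qed.

End RiemannianBalls.

Theorem proposition3p1 (K : realType) (n : nat) (n_ge1 : (1 <= n)%N) (H : K)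
  (M : nat -> metricType K) (g : forall i, riemannian n (M i))
  (p : forall i, M i)
  (M_complete : forall i, complete_metric (M i))
  (M_ricci : forall i, ricci_ge (g i) ((n%:R - 1) * H))
  (Y : metricType K) (y : Y) (Y_length : is_length_space Y)
  (M_cvg : pointed_gh_cvg (fun i => [set: M i]) (fun i => @emdist K (M i)) p
             [set: Y] (@emdist K Y) y)
  (R r : K) (R_gt0 : 0 < R) (r_gt0 : 0 < r) (r_lt : r < R / 3)
  (r_ R_ : nat -> K) (r_R_ : forall i, 0 < r_ i < R_ i)
  (r_cvg : r_ i @[i --> \oo] --> r) (R_cvg : R_ i @[i --> \oo] --> R)
  (ball_r_cvg :
     gh_cvg (fun i => cball (@emdist K (M i)) (p i) (r_ i))
       (fun i => intrinsic_dist (@emdist K (M i))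
                   (cball (@emdist K (M i)) (p i) (r_ i)))
       (cball (@emdist K Y) y r)
       (intrinsic_dist (@emdist K Y) (cball (@emdist K Y) y r)))
  (ball_R_cvg :
     gh_cvg (fun i => cball (@emdist K (M i)) (p i) (R_ i))
       (fun i => intrinsic_dist (@emdist K (M i))
                   (cball (@emdist K (M i)) (p i) (R_ i)))
       (cball (@emdist K Y) y R)
       (intrinsic_dist (@emdist K Y) (cball (@emdist K Y) y R)))
  (delta : K) (delta_gt0 : 0 < delta) (delta_lt : delta < r / 2)
  (E : nat -> topologicalType)
  (cov : forall i, E i -> intrinsic_ball (p i) (R_ i))
  (pt : forall i, E i)
  (pt_lift : forall i, to_space (cov i (pt i)) = p i)
  (cov_delta : forall i, is_delta_cover (@ball_dist K (M i) (p i) (R_ i)) delta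
                           (cov i (pt i)) (cov i)) :
  exists2 phi : nat -> nat, {homo phi : i j / (i < j)%N} &
  exists (Z : metricType K) (z : Z),
    pointed_gh_cvg
      (fun i => rel_cover (cov (phi i)) (r_ (phi i)) (pt (phi i)))
      (fun i => rel_cover_dist (cov (phi i)) (r_ (phi i)) (pt (phi i)))
      (fun i => pt (phi i))
      [set: Z] (@emdist K Z) z.
Proof.
have ri_gt0 i : 0 < r_ i by case/andP: (r_R_ i).
have r_le i : r_ i <= R_ i by case/andP: (r_R_ i) => _ /ltW.
have fcov i : is_covering_map (cov i) by case: (cov_delta i).
have pt_in i : cball (@emdist K (M i)) (p i) (r_ i) (to_space (cov i (pt i))).
  by rewrite pt_lift /cball/= /emdist mdistxx lee_fin ltW.
have pA i : cball (@emdist K (M i)) (p i) (r_ i) (p i).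
  by have := pt_in i; rewrite pt_lift.
have base := gh_cvg_uniform_net ball_r_cvg pA (fun i e e0 =>
  riemannian_intrinsic_net (g i) (@M_complete i) (p i) (ri_gt0 i) e0).
pose C i := rel_cover (cov i) (r_ i) (pt i).
pose d i := rel_cover_dist (cov i) (r_ i) (pt i).
have d_epm i : is_epseudometric (C i) (d i) by exact: rel_cover_dist_epm.
have Cpt i : C i (pt i) by exact: rel_cover_pt.
have div i : radially_divisible (C i) (d i) (pt i).
  by move=> x L t _; exact: rel_cover_intermediate.
apply: (gromov_precompactness d_epm Cpt div).
have eta0 : 0 < delta / 8 by rewrite divr_gt0.
apply: (has_local_nets_has_nets d_epm Cpt div eta0) => e e0.
(* The cap keeps [2 * (delta / 8 + e1)] at most [delta / 2], below the [delta] needed for unique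
   lifts. The base net has size [e1 / 2] because its lifts are found at distance strictly less than
   the size upstairs. *)
pose e1 := Num.min e (delta / 8).
have e1_gt0 : 0 < e1 by rewrite lt_min e0.
have e1e : e1 <= e by rewrite ge_min lexx.
have e1d : e1 <= delta / 8 by rewrite ge_min lexx orbT.
have e2_gt0 : 0 < e1 / 2 by rewrite divr_gt0.
have [N NP] := base (e1 / 2) e2_gt0; exists N.
apply: filterS NP => i [q [_ qP]] x Cx.
have [||c [cC cP]] := rel_cover_net (fcov i) (r_le i) (cov_delta i) qP
  (e' := e1) (eta := delta / 8) _ _ Cx; [lra|lra|].
exists c; split => // w Cw /(cP w Cw)[j jN cw]; exists j => //.
by apply: (le_trans cw); rewrite lee_fin.
Qed.
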